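(* Let $k\in(0,1)$. Assume $u_0\in\mathcal{C}^2(\mathbb{R})$, $u_1\in\mathcal{C}^1(\mathbb{R})$ and $g\in\mathcal{C}^{0,1}_{t,x}([1,\infty)\times\mathbb{R})$. Then the solution $u$ to the Cauchy problem $$\begin{cases} \partial_t^2 u- t^{-2k} \partial_x^2 u +2 \, t^{-1}\partial_t u=g(t,x), & x\in \mathbb{R}, \ t>1,\\ u(1,x)=u_0(x), & x\in \mathbb{R}, \\ \partial_t u(1,x)=u_1(x), & x\in \mathbb{R},\end{cases}$$ is given by the representation formula $$\begin{aligned} u(t,x) &= \frac{1}{2}t^{\frac{k}{2}-1}\big(u_0(x+A_k(t))+u_0(x-A_k(t))\big)+\int_{x-A_k(t)}^{x+A_k(t)} u_0(y) K_0(t,x;y)\, \mathrm{d}y \\ & \quad +\int_{x-A_k(t)}^{x+A_k(t)} u_1(y)K_1(t,x;y)\, \mathrm{d}y + \int_1^t \int_{x-\phi_k(t)+\phi_k(b)}^{x+\phi_k(t)-\phi_k(b)} g(b,y) E(t,x;b,y) \, \mathrm{d}y\, \mathrm{d}b. \end{aligned}$$ Here the kernel function $E$ is defined by $$E(t,x;b,y) = c\, t^{-1} b \left((\phi_k(t)+\phi_k(b))^2-(y-x)^2\right)^{-\gamma} \mathsf{F}\left(\gamma,\gamma;1; \frac{(\phi_k(t)-\phi_k(b))^2-(y-x)^2}{(\phi_k(t)+\phi_k(b))^2-(y-x)^2} \right),$$ where $$c = 2^{-\frac{1}{1-k}}(1-k)^{\frac{k}{1-k}},\qquad \gamma = -\frac{k}{2(1-k)},$$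 and the kernel functions $K_0,K_1$ are given by $$K_0(t,x;y)=2E(t,x;1,y)-\frac{\partial}{\partial b}E(t,x;b,y)\Big|_{b=1},\qquad K_1(t,x;y)=E(t,x;1,y).$$
   Context: Notation. $\phi_k(t)=\frac{t^{1-k}}{1-k}$ and $A_k(t)=\phi_k(t)-\phi_k(1)=\int_1^t\tau^{-k}\,\mathrm{d}\tau$. $\mathsf{F}(\alpha_1,\alpha_2;\beta;z)$ denotes the Gauss hypergeometric function. $g\in\mathcal{C}^{0,1}_{t,x}([1,\infty)\times\mathbb{R})$ means that $g$ is continuous in $(t,x)$ and continuously differentiable with respect to $x$. *)

(* Defs.v *)
From Stdlib Require Import Reals Factorial.
From Coquelicot Require Import Coquelicot.

Open Scope R_scope.

Definition phi (k t : R) : R := Rpower t (1 - k) / (1 - k).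

Definition A (k t : R) : R := phi k t - phi k 1.

Fixpoint rising (a : R) (n : nat) : R :=
  match n with
  | O => 1
  | S m => rising a m * (a + INR m)
  end.

(* Only meaningful for [Rabs z < 1]; elsewhere [PSeries] is a default value.
   In [E] below the argument lies in [0, 1) on the backward light cone
   [Rabs (y - x) <= phi k t - phi k b], [1 <= b <= t], and in (-1, 1) for [b] in
   a neighbourhood of 1, as needed for the derivative in [K0]. *)
Definition hyp2F1 (a1 a2 b z : R) : R :=
  PSeries
    (fun n => rising a1 n * rising a2 n / (rising b n * INR (fact n))) z.

Definition gamma (k : R) : R := - (k / (2 * (1 - k))).

Definition c (k : R) : R :=
  Rpower 2 (- (1 / (1 - k))) * Rpower (1 - k) (k / (1 - k)).

Definition E (k t x b y : R) : R :=
  c k * / t * b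
  * Rpower ((phi k t + phi k b) ^ 2 - (y - x) ^ 2) (- gamma k)
  * hyp2F1 (gamma k) (gamma k) 1
      (((phi k t - phi k b) ^ 2 - (y - x) ^ 2)
       / ((phi k t + phi k b) ^ 2 - (y - x) ^ 2)).

Definition K0 (k t x y : R) : R :=
  2 * E k t x 1 y - Derive (fun b => E k t x b y) 1.

Definition K1 (k t x y : R) : R := E k t x 1 y.

Definition class_C (n : nat) (f : R -> R) : Prop :=
  forall m : nat, (m <= n)%nat ->
  forall x : R, ex_derive_n f m x /\ continuous (Derive_n f m) x.

(* Functions on [1, oo) x R are represented by total functions of (t, x) whose
   values for t < 1 are irrelevant: continuity is relative to the closed
   half-plane and time derivatives at t = 1 are one-sided. *)
Definition continuous_half (f : R -> R -> R) : Prop :=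
  continuous_on (fun p : R * R => 1 <= fst p) (fun p => f (fst p) (snd p)).

(* l is the derivative at t (1 <= t) of f restricted to [1, oo) *)
Definition is_derive_half (f : R -> R) (t l : R) : Prop :=
  filterdiff f (within (fun s => 1 <= s) (locally t)) (fun h => scal h l).

Fixpoint class_C_half (n : nat) (f : R -> R -> R) : Prop :=
  continuous_half f /\
  match n with
  | O => True
  | S m => exists ft fx : R -> R -> R,
      (forall t x, 1 <= t ->
         is_derive_half (fun s => f s x) t (ft t x) /\
         is_derive (fun y => f t y) x (fx t x)) /\
      class_C_half m ft /\ class_C_half m fx
  end.

Definition class_C01 (g : R -> R -> R) : Prop :=
  continuous_half g /\
  exists gx : R -> R -> R,
    (forall t x, 1 <= t -> is_derive (fun y => g t y) x (gx t x)) /\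
    continuous_half gx.

Definition is_solution (k : R) (u0 u1 : R -> R) (g u : R -> R -> R) : Prop :=
  class_C_half 2 u /\
  (forall t x, 1 < t ->
     Derive_n (fun s => u s x) 2 t
     - Rpower t (- (2 * k)) * Derive_n (fun y => u t y) 2 x
     + 2 * / t * Derive (fun s => u s x) t = g t x) /\
  (forall x, u 1 x = u0 x) /\
  (forall x, is_derive_half (fun t => u t x) 1 (u1 x)).

(* Main.v *)
Require Import Defs.
From Stdlib Require Import Reals Factorial Lra Lia.
From Coquelicot Require Import Coquelicot.

(** Two substitutions flatten the problem. The new time [T = phi k t] turns the
    characteristics into straight lines, and [u = t^(k/2-1) w] removes every
    first-order term: [w] satisfies [w_TT - w_xx = mu / T^2 w + f] for [T] at
    least [phi k 1], with [mu = gamma (gamma - 1)] and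
    [f = t^(1+3k/2) g] ([lifted_equation], [flat_equation]).

    The Riemann function of this equation depends on one variable:
    [R (T, B, r) = P (zeta) / 2] with [zeta = ((T - B)^2 - r^2) / (4 T B)]. The
    wave operator acts on functions of [zeta] as Legendre's operator divided by
    [T^2] ([kern_equation]), so [P] has to be the solution of Legendre's equation
    that is regular at [zeta = 0], where [P] equals 1. Pfaff's transformation
    writes it as [(1 + zeta)^(-gamma) F (gamma, gamma; 1; zeta / (1 + zeta))],
    whose argument [zeta / (1 + zeta)] is the one in the definition of [E]. This
    gives [E = t^(k/2-1) b^(1+k/2) R] inside the light cone ([E_eq_kern]); the
    constant [c] is exactly what makes [R] equal to 1/2 on the characteristics.

    Every solution is given by the formula, by Riemann's method. Fix the apex
    [(T, x)] of the backward cone and consider, on its slice at time [B], the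
    integral of [w_B R - w R_B] plus half the sum of the values of [w] at the two
    end points. The derivative of this functional in [B] is the integral of
    [f R] over the slice ([is_derive_riemann_functional]); its value at [B = T]
    is [w (T, x)]; its value at [B = phi k 1] contains the initial data, and
    produces [K0], [K1] and the boundary term. Integration in [B] is the
    representation formula.

    A solution exists, because the same kernel solves the problem with zero
    data: superpose over [B] the waves, the integrals of [f R] over the slices
    ([duhamel_solution]). As [f] has only one derivative in [x], second
    derivatives are taken after an integration by parts. General data are
    carried by a solution of d'Alembert's equation, whose defect [mu / T^2 p] is
    a source of the same regularity ([flat_cauchy_problem]).

    Both halves work on slices folded around [x], with the variable
    [r = |y - x|] between 0 and [T - B]: the kernel is even in [y - x], and only
    one end point moves. *)

Open Scope R_scope.

(** * Calculus of real functions *)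

Lemma is_derive_R_mult (f g : R -> R) (x df dg : R) :
  is_derive f x df -> is_derive g x dg ->
  is_derive (fun t => f t * g t) x (df * g x + f x * dg).
Proof.
intros Hf Hg. exact (is_derive_mult f g x df dg Hf Hg Rmult_comm).
Qed.

Lemma is_derive_R_plus (f g : R -> R) (x df dg : R) :
  is_derive f x df -> is_derive g x dg ->
  is_derive (fun t => f t + g t) x (df + dg).
Proof. exact (is_derive_plus f g x df dg). Qed.

Lemma is_derive_R_comp (f g : R -> R) (x df dg : R) :
  is_derive f (g x) df -> is_derive g x dg ->
  is_derive (fun t => f (g t)) x (df * dg).
Proof.
intros Hf Hg. rewrite Rmult_comm. exact (is_derive_comp f g x df dg Hf Hg).
Qed.

Lemma is_derive_R_scal (f : R -> R) (x c df : R) :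
  is_derive f x df -> is_derive (fun t => c * f t) x (c * df).
Proof. exact (is_derive_scal f x c df). Qed.

Lemma is_derive_R_eq (f : R -> R) (x l l' : R) :
  is_derive f x l -> l = l' -> is_derive f x l'.
Proof. now intros H <-. Qed.

Lemma is_derive_R_ext_loc (f g : R -> R) (x l : R) :
  locally x (fun t => f t = g t) -> is_derive f x l -> is_derive g x l.
Proof. exact (is_derive_ext_loc f g x l). Qed.

Lemma is_derive_R_continuous (f : R -> R) (x l : R) :
  is_derive f x l -> continuous f x.
Proof.
intros H. apply (ex_derive_continuous (K := R_AbsRing) (V := R_NormedModule)).
now exists l.
Qed.

Lemma ex_RInt_R (f : R -> R) (a b : R) :
  (forall z, continuous f z) -> ex_RInt f a b.
Proof.
intros H. apply (ex_RInt_continuous (V := R_CompleteNormedModule)). auto.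
Qed.


Lemma RInt_R_ext (f g : R -> R) (a b : R) :
  (forall r, Rmin a b < r < Rmax a b -> f r = g r) -> RInt f a b = RInt g a b.
Proof. exact (RInt_ext (V := R_CompleteNormedModule) f g a b). Qed.

Lemma RInt_R_plus (f g : R -> R) (a b : R) :
  ex_RInt f a b -> ex_RInt g a b ->
  RInt (fun r => f r + g r) a b = RInt f a b + RInt g a b.
Proof. exact (RInt_plus (V := R_CompleteNormedModule) f g a b). Qed.

Lemma RInt_R_minus (f g : R -> R) (a b : R) :
  ex_RInt f a b -> ex_RInt g a b ->
  RInt (fun r => f r - g r) a b = RInt f a b - RInt g a b.
Proof. exact (RInt_minus (V := R_CompleteNormedModule) f g a b). Qed.

Lemma RInt_R_scal (f : R -> R) (c a b : R) :
  ex_RInt f a b -> RInt (fun r => c * f r) a b = c * RInt f a b.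
Proof. exact (RInt_scal (V := R_CompleteNormedModule) f a b c). Qed.

Lemma RInt_R_derive (f df : R -> R) (a b : R) :
  (forall r, Rmin a b <= r <= Rmax a b -> is_derive f r (df r)) ->
  (forall r, Rmin a b <= r <= Rmax a b -> continuous df r) ->
  RInt df a b = f b - f a.
Proof.
intros Hd Hc. apply (is_RInt_unique (V := R_CompleteNormedModule)).
now apply (is_RInt_derive (V := R_CompleteNormedModule)).
Qed.

Lemma cont_plus {U : UniformSpace} (f g : U -> R) (p : U) :
  continuous f p -> continuous g p -> continuous (fun q => f q + g q) p.
Proof. exact (continuous_plus (V := R_NormedModule) f g p). Qed.

Lemma cont_opp {U : UniformSpace} (f : U -> R) (p : U) :
  continuous f p -> continuous (fun q => - f q) p.
Proof. exact (continuous_opp (V := R_NormedModule) f p). Qed.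

Lemma cont_minus {U : UniformSpace} (f g : U -> R) (p : U) :
  continuous f p -> continuous g p -> continuous (fun q => f q - g q) p.
Proof. exact (continuous_minus (V := R_NormedModule) f g p). Qed.

Lemma cont_mult {U : UniformSpace} (f g : U -> R) (p : U) :
  continuous f p -> continuous g p -> continuous (fun q => f q * g q) p.
Proof. exact (continuous_mult (K := R_AbsRing) f g p). Qed.

Lemma cont_pow {U : UniformSpace} (f : U -> R) (n : nat) (p : U) :
  continuous f p -> continuous (fun q => f q ^ n) p.
Proof.
intros Hf. induction n as [|n IH]; simpl.
- apply continuous_const.
- now apply cont_mult.
Qed.

Lemma cont_inv {U : UniformSpace} (f : U -> R) (p : U) :
  continuous f p -> f p <> 0 -> continuous (fun q => / f q) p.
Proof.
intros Hf Hn. apply (continuous_comp f Rinv); [exact Hf|].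
apply continuity_pt_filterlim. apply (continuity_pt_inv (fun x => x)); [|exact Hn].
apply continuity_pt_filterlim, continuous_id.
Qed.

Lemma cont_Rmax {U : UniformSpace} (f : U -> R) (c : R) (p : U) :
  continuous f p -> continuous (fun q => Rmax (f q) c) p.
Proof.
intros Hf.
apply continuous_ext with (fun q => (f q + c + Rabs (f q - c)) * / 2).
- intros q. unfold Rmax, Rabs. destruct Rle_dec, Rcase_abs; lra.
- apply cont_mult; [|apply continuous_const].
  apply cont_plus.
  + apply cont_plus; [exact Hf|apply continuous_const].
  + apply (continuous_comp (fun q => f q - c) Rabs); [|apply continuous_Rabs].
    apply cont_minus; [exact Hf|apply continuous_const].
Qed.

Lemma cont_comp {U : UniformSpace} (h : R -> R) (f : U -> R) (p : U) :
  continuous f p -> continuous h (f p) -> continuous (fun q => h (f q)) p.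
Proof. intros Hf Hh. exact (continuous_comp f h p Hf Hh). Qed.

Lemma cont_comp_2 {U : UniformSpace} (h : R -> R -> R) (f g : U -> R) (p : U) :
  continuous f p -> continuous g p ->
  continuous (fun q : R * R => h (fst q) (snd q)) (f p, g p) ->
  continuous (fun q => h (f q) (g q)) p.
Proof. intros Hf Hg Hh. exact (continuous_comp_2 f g h p Hf Hg Hh). Qed.

(** The shape of the function is read off syntactically: unification would
    unfold the operations of the reals. *)
Ltac cont_step :=
  lazymatch goal with
  | |- continuous (fun _ => ?a) _ => apply continuous_const
  | |- continuous (fun q => q) _ => apply continuous_id
  | |- continuous (fun q => fst q) _ => apply continuous_fst
  | |- continuous (fun q => snd q) _ => apply continuous_snd
  | |- continuous (fun q => @?f q - @?g q) _ => apply (cont_minus f g)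
  | |- continuous (fun q => @?f q + @?g q) _ => apply (cont_plus f g)
  | |- continuous (fun q => @?f q * @?g q) _ => apply (cont_mult f g)
  | |- continuous (fun q => @?f q ^ ?n) _ => apply (cont_pow f n)
  | |- continuous (fun q => - @?f q) _ => apply (cont_opp f)
  | |- _ => assumption
  end.

(** * Integrals depending on parameters *)

Lemma uniformly_close_on_segment {U : UniformSpace} (Phi : U -> R -> R)
  (a b : R) (p0 : U) :
  (forall s, a <= s <= b ->
     continuous (fun q : U * R => Phi (fst q) (snd q)) (p0, s)) ->
  forall eps : posreal,
  locally p0 (fun p => forall s, a <= s <= b -> Rabs (Phi p s - Phi p0 s) < eps).
Proof.
intros HC eps.
assert (H : forall s : R, exists d : posreal, a <= s <= b ->
  forall q : U * R, ball (p0, s) d q ->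
  Rabs (Phi (fst q) (snd q) - Phi p0 s) < eps / 2).
{ intros s. destruct (Rle_dec a s) as [h1|h1].
  2: now exists (mkposreal 1 Rlt_0_1).
  destruct (Rle_dec s b) as [h2|h2].
  2: now exists (mkposreal 1 Rlt_0_1).
  destruct (HC s (conj h1 h2) _ (locally_ball _ (pos_div_2 eps))) as [d Hd].
  exists d. intros _ q Hq. exact (Hd q Hq). }
assert (H' : forall s : R, {d : posreal | a <= s <= b ->
  forall q : U * R, ball (p0, s) d q ->
  Rabs (Phi (fst q) (snd q) - Phi p0 s) < eps / 2}).
{ intros s. destruct (Rle_dec a s) as [h1|h1].
  2: now exists (mkposreal 1 Rlt_0_1).
  destruct (Rle_dec s b) as [h2|h2].
  2: now exists (mkposreal 1 Rlt_0_1).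
  destruct (locally_ex_dec (p0, s)
    (fun q : U * R => Rabs (Phi (fst q) (snd q) - Phi p0 s) < eps / 2)) as [d Hd].
  - intros q. destruct (Rlt_dec (Rabs (Phi (fst q) (snd q) - Phi p0 s)) (eps / 2)); auto.
  - destruct (H s) as [d Hd]. exists d. intros q Hq. now apply Hd.
  - exists d. intros _ q Hq. now apply Hd. }
destruct (compactness_value_1d a b (fun s => proj1_sig (H' s))) as [d Hd].
exists d. intros p Hp s Hs.
destruct (Rlt_dec (Rabs (Phi p s - Phi p0 s)) eps) as [h|h]; trivial.
exfalso. apply (Hd s Hs). intros (t & Ht & Hst & Hdt). apply h.
destruct (H' t) as [dt Hdt']; simpl in *.
assert (H1 : Rabs (Phi p s - Phi p0 t) < eps / 2).
{ apply (Hdt' Ht (p, s)). split; simpl.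
  - now apply ball_le with d.
  - exact Hst. }
assert (H2 : Rabs (Phi p0 s - Phi p0 t) < eps / 2).
{ apply (Hdt' Ht (p0, s)). split; simpl.
  - apply ball_center.
  - exact Hst. }
revert H1 H2. unfold Rabs; repeat destruct Rcase_abs; lra.
Qed.

Lemma continuous_RInt_param {U : UniformSpace} (Phi : U -> R -> R)
  (a b : R) (p0 : U) :
  a <= b ->
  locally p0 (fun p => forall s, a <= s <= b -> continuous (Phi p) s) ->
  (forall s, a <= s <= b ->
     continuous (fun q : U * R => Phi (fst q) (snd q)) (p0, s)) ->
  continuous (fun p => RInt (Phi p) a b) p0.
Proof.
intros hab Hloc HC.
apply filterlim_locally. intros eps.
assert (He : 0 < eps / (b - a + 1)).
{ apply Rdiv_lt_0_compat; [apply eps | lra]. }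
assert (Hex : forall p, (forall s, a <= s <= b -> continuous (Phi p) s) ->
  ex_RInt (Phi p) a b).
{ intros p Hp. apply (ex_RInt_continuous (V := R_CompleteNormedModule)). intros s.
  rewrite Rmin_left, Rmax_right by lra. apply Hp. }
assert (Hex0 := Hex _ (locally_singleton _ _ Hloc)).
generalize (filter_and _ _ Hloc
  (uniformly_close_on_segment Phi a b p0 HC (mkposreal _ He))).
apply filter_imp. intros p [Hp Hclose]. simpl in Hclose.
change (Rabs (RInt (Phi p) a b - RInt (Phi p0) a b) < eps).
replace (RInt (Phi p) a b - RInt (Phi p0) a b)
  with (RInt (fun s => minus (Phi p s) (Phi p0 s)) a b).
2: apply (RInt_minus (V := R_CompleteNormedModule)); auto.
assert (Hb := abs_RInt_le_const (fun s => minus (Phi p s) (Phi p0 s)) a b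
  (eps / (b - a + 1)) hab).
apply Rle_lt_trans with ((b - a) * (eps / (b - a + 1))).
- apply Hb.
  + apply (ex_RInt_minus (V := R_NormedModule)); auto.
  + intros s Hs. left. now apply Hclose.
- replace (pos eps) with ((b - a + 1) * (eps / (b - a + 1))) at 2 by (field; lra).
  apply Rmult_lt_compat_r; lra.
Qed.

(** Scaling maps the interval to [[0, 1]]; the moving end point then enters
    through the integrand. *)
Lemma continuous_RInt_upper {U : UniformSpace} (Phi : U -> R -> R)
  (a : R) (d : U -> R) (p0 : U) :
  continuous d p0 ->
  locally p0 (fun p => forall s,
     continuous (fun q : U * R => Phi (fst q) (snd q)) (p, s)) ->
  continuous (fun p => RInt (Phi p) a (d p)) p0.
Proof.
intros Hd HC.
assert (Hs : forall p, (forall s,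
     continuous (fun q : U * R => Phi (fst q) (snd q)) (p, s)) ->
   forall s, continuous (Phi p) s).
{ intros p Hp s.
  apply (continuous_comp_2 (fun _ : R => p) (fun r : R => r) Phi).
  - apply continuous_const.
  - apply continuous_id.
  - apply Hp. }
apply continuous_ext_loc with
  (fun p => RInt (fun s => scal (d p - a) (Phi p ((d p - a) * s + a))) 0 1).
{ revert HC. apply filter_imp. intros p Hp.
  rewrite (RInt_comp_lin (Phi p)).
  - f_equal; simpl; ring.
  - apply (ex_RInt_continuous (V := R_CompleteNormedModule)).
    intros z _. now apply Hs. }
apply continuous_RInt_param.
- lra.
- revert HC. apply filter_imp. intros p Hp s _.
  apply (continuous_scal_r (V := R_NormedModule)).
  apply continuous_comp; [|now apply Hs].
  apply (continuous_plus (V := R_NormedModule)); [|apply continuous_const].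
  apply (continuous_scal_r (V := R_NormedModule)). apply continuous_id.
- intros s _.
  assert (Hdp : continuous (fun q : U * R => d (fst q) - a) (p0, s)).
  { apply (continuous_minus (V := R_NormedModule)); [|apply continuous_const].
    apply (continuous_comp (fun q : U * R => fst q) d); [apply continuous_fst|exact Hd]. }
  apply (continuous_mult (K := R_AbsRing)); [exact Hdp|].
  apply (continuous_comp_2 (fun q : U * R => fst q)
    (fun q : U * R => (d (fst q) - a) * snd q + a) Phi).
  + apply continuous_fst.
  + apply (continuous_plus (V := R_NormedModule)); [|apply continuous_const].
    apply (continuous_mult (K := R_AbsRing)); [exact Hdp|apply continuous_snd].
  + apply (locally_singleton _ _ HC).
Qed.

Lemma is_derive_RInt_upper (Phi Phi' : R -> R -> R) (D : R -> Prop)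
  (a : R) (d : R -> R) (x dd : R) :
  open D -> D x ->
  (forall t s, D t -> is_derive (fun t => Phi t s) t (Phi' t s)) ->
  (forall t s, D t -> continuous (fun s => Phi t s) s) ->
  (forall t s, D t ->
     continuous (fun q : R * R => Phi' (fst q) (snd q)) (t, s)) ->
  is_derive d x dd ->
  is_derive (fun t => RInt (fun s => Phi t s) a (d t)) x
    (RInt (fun s => Phi' x s) a (d x) + Phi x (d x) * dd).
Proof.
intros Dop Dx Hder HC HC' Hd.
assert (Dloc : locally x D) by now apply Dop.
assert (Hex : forall t u v, D t -> ex_RInt (fun s => Phi t s) u v).
{ intros t u v Ht. apply (ex_RInt_continuous (V := R_CompleteNormedModule)).
  intros z _. now apply HC. }
assert (H2d : forall s, D x -> continuity_2d_pt
   (fun u v => Derive (fun z : R => Phi z v) u) x s).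
{ intros s _. apply continuity_2d_pt_filterlim.
  generalize (HC' x s Dx). unfold continuous; simpl.
  replace (Derive (fun z : R => Phi z s) x) with (Phi' x s)
    by (symmetry; apply is_derive_unique; auto).
  apply filterlim_ext_loc.
  destruct Dloc as [e He]. exists e. intros [u v] [Hu _]; simpl in *.
  symmetry. apply is_derive_unique, Hder, He, Hu. }
assert (H2l : forall s, locally_2d (fun x' t : R => continuity_2d_pt
   (fun u v => Derive (fun z : R => Phi z v) u) x' t) x s).
{ intros s. apply locally_2d_locally. destruct Dloc as [e He]. exists e.
  intros [u v] [Hu _]; simpl in *. assert (Du := He _ Hu).
  apply continuity_2d_pt_filterlim.
  generalize (HC' u v Du). unfold continuous; simpl.
  replace (Derive (fun z : R => Phi z v) u) with (Phi' u v)
    by (symmetry; apply is_derive_unique; auto).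
  apply filterlim_ext_loc.
  destruct (Dop _ Du) as [e' He']. exists e'. intros [u' v'] [Hu' _]; simpl in *.
  symmetry. apply is_derive_unique, Hder, He', Hu'. }
replace (RInt (fun s => Phi' x s) a (d x))
  with (RInt (fun t : R => Derive (fun u : R => Phi u t) x) a (d x)).
2: { apply RInt_R_ext. intros s _. now apply is_derive_unique, Hder. }
apply (is_derive_RInt_param_bound_comp_aux3 Phi a d x dd); auto.
- revert Dloc. apply filter_imp. intros t Ht; auto.
- exists (mkposreal 1 Rlt_0_1). revert Dloc. apply filter_imp. intros t Ht; auto.
- exists (mkposreal 1 Rlt_0_1). revert Dloc. apply filter_imp.
  intros t Ht s _. exists (Phi' t s). auto.
- apply continuity_pt_filterlim. now apply HC.
Qed.

(** * The hypergeometric function and Legendre's equation *)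

Definition hcoef (g : R) (n : nat) : R :=
  rising g n * rising g n / (rising 1 n * INR (fact n)).

Lemma rising_1 (n : nat) : rising 1 n = INR (fact n).
Proof.
induction n as [|n IH]; [reflexivity|].
change (rising 1 n * (1 + INR n) = INR (fact n + n * fact n)).
rewrite IH, plus_INR, mult_INR. ring.
Qed.

Lemma hcoef_S (g : R) (n : nat) :
  INR (S n) * (INR (S n) * hcoef g (S n)) = (g + INR n) ^ 2 * hcoef g n.
Proof.
unfold hcoef. rewrite !rising_1, fact_simpl, mult_INR.
change (rising g (S n)) with (rising g n * (g + INR n)).
assert (H1 := INR_fact_neq_0 n).
assert (H2 : INR (S n) <> 0) by (apply not_0_INR; lia).
field; auto.
Qed.

(** The ratio of consecutive coefficients is at most 1 as soon as [n >= - g];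
    an early coefficient may vanish, which rules out the ratio test. *)
Lemma hcoef_bounded (g : R) :
  g <= 1 -> exists M, forall n, Rabs (hcoef g n) <= M.
Proof.
intros hg.
assert (Hfin : forall N, exists M, forall n, (n <= N)%nat -> Rabs (hcoef g n) <= M).
{ induction N as [|N [M HM]].
  - exists (Rabs (hcoef g 0)). intros n Hn. replace n with 0%nat by lia. lra.
  - exists (Rmax M (Rabs (hcoef g (S N)))). intros n Hn.
    destruct (Nat.eq_dec n (S N)) as [->|Hne]; [apply Rmax_r|].
    apply Rle_trans with M; [apply HM; lia|apply Rmax_l]. }
destruct (INR_unbounded (- g)) as [N HN].
destruct (Hfin N) as [M HM]. exists M.
assert (Hind : forall m, Rabs (hcoef g (N + m)) <= M).
{ induction m as [|m IH]; [apply HM; lia|].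
  rewrite Nat.add_succ_r.
  apply Rle_trans with (2 := IH). set (n := (N + m)%nat) in *.
  assert (Hn : INR N <= INR n) by (apply le_INR; unfold n; lia).
  assert (Hpos : 0 < INR (S n)) by (apply lt_0_INR; lia).
  assert (HS := S_INR n).
  replace (hcoef g (S n)) with
    (((g + INR n) / INR (S n)) ^ 2 * hcoef g n).
  2: { apply (Rmult_eq_reg_l (INR (S n))); [|lra].
       apply (Rmult_eq_reg_l (INR (S n))); [|lra].
       rewrite hcoef_S. field. lra. }
  rewrite Rabs_mult.
  rewrite <- (Rmult_1_l (Rabs (hcoef g n))) at 2.
  apply Rmult_le_compat_r; [apply Rabs_pos|].
  assert (Hq : 0 <= (g + INR n) / INR (S n) <= 1).
  { split.
    - apply Rmult_le_pos; [lra|left; now apply Rinv_0_lt_compat].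
    - apply Rmult_le_reg_r with (INR (S n)); [lra|].
      unfold Rdiv. rewrite Rmult_assoc, Rinv_l; lra. }
  rewrite Rabs_pos_eq; nra. }
intros n. destruct (Nat.le_gt_cases n N) as [h|h]; [now apply HM|].
replace n with (N + (n - N))%nat by lia. apply Hind.
Qed.

Lemma CV_radius_bounded_coef (a : nat -> R) (M z : R) :
  (forall n, Rabs (a n) <= M) -> Rabs z < 1 -> Rbar_lt (Rabs z) (CV_radius a).
Proof.
intros HM Hz. apply Rbar_lt_le_trans with 1; [exact Hz|].
apply (CV_radius_bounded a). exists M. intros n.
rewrite pow1, Rmult_1_r. apply HM.
Qed.

Definition hyp_F (g z : R) : R := PSeries (hcoef g) z.
Definition hyp_F1 (g z : R) : R := PSeries (PS_derive (hcoef g)) z.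
Definition hyp_F2 (g z : R) : R := PSeries (PS_derive (PS_derive (hcoef g))) z.
Definition hyp_F3 (g z : R) : R :=
  PSeries (PS_derive (PS_derive (PS_derive (hcoef g)))) z.

Lemma hyp_radius (g z : R) :
  g <= 1 -> Rabs z < 1 -> Rbar_lt (Rabs z) (CV_radius (hcoef g)).
Proof.
intros hg hz. destruct (hcoef_bounded g hg) as [M HM].
now apply CV_radius_bounded_coef with M.
Qed.

Lemma is_derive_hyp_F (g z : R) :
  g <= 1 -> Rabs z < 1 -> is_derive (hyp_F g) z (hyp_F1 g z).
Proof. intros hg hz. now apply is_derive_PSeries, hyp_radius. Qed.

Lemma is_derive_hyp_F1 (g z : R) :
  g <= 1 -> Rabs z < 1 -> is_derive (hyp_F1 g) z (hyp_F2 g z).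
Proof.
intros hg hz. apply is_derive_PSeries.
rewrite CV_radius_derive. now apply hyp_radius.
Qed.

Lemma is_derive_hyp_F2 (g z : R) :
  g <= 1 -> Rabs z < 1 -> is_derive (hyp_F2 g) z (hyp_F3 g z).
Proof.
intros hg hz. apply is_derive_PSeries.
rewrite !CV_radius_derive. now apply hyp_radius.
Qed.

(** In terms of [theta f = z f'] the recursion of the coefficients says
    [(theta F)' = (theta + g)^2 F]. *)
Lemma hyp_F_ode (g z : R) :
  g <= 1 -> Rabs z < 1 ->
  z * (1 - z) * hyp_F2 g z + (1 - (1 + 2 * g) * z) * hyp_F1 g z
  = g ^ 2 * hyp_F g z.
Proof.
intros hg hz.
assert (Hr := hyp_radius g z hg hz).
set (a := hcoef g) in *.
set (th := fun b : nat -> R => PS_incr_1 (PS_derive b)).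
assert (Hth : forall b n, th b n = INR n * b n).
{ intros b [|n]; unfold th, PS_incr_1, PS_derive; simpl.
  - unfold zero; simpl. ring.
  - reflexivity. }
assert (Hrth : forall b, Rbar_lt (Rabs z) (CV_radius b) ->
  Rbar_lt (Rabs z) (CV_radius (th b))).
{ intros b Hb. unfold th. rewrite CV_radius_incr_1, CV_radius_derive. exact Hb. }
assert (Hval : forall b, PSeries (th b) z = z * PSeries (PS_derive b) z).
{ intros b. unfold th. now rewrite PSeries_incr_1. }
assert (Hder : PSeries (PS_derive (th a)) z = hyp_F1 g z + z * hyp_F2 g z).
{ rewrite <- (is_derive_unique _ _ _ (is_derive_PSeries _ _ (Hrth a Hr))).
  apply is_derive_unique.
  apply is_derive_ext with (fun t => t * hyp_F1 g t).
  { intros t. unfold th. now rewrite PSeries_incr_1. }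
  auto_derive.
  - exists (hyp_F2 g z). now apply is_derive_hyp_F1.
  - replace (Derive (fun x : R => hyp_F1 g x) z) with (hyp_F2 g z)
      by (symmetry; now apply is_derive_unique, is_derive_hyp_F1).
    ring. }
assert (Hsum : PSeries (PS_derive (th a)) z =
  PSeries (th (th a)) z + (2 * g * PSeries (th a) z + g ^ 2 * PSeries a z)).
{ assert (Hr1 := Hrth _ Hr). assert (Hr2 := Hrth _ Hr1).
  assert (Hex : forall b, Rbar_lt (Rabs z) (CV_radius b) -> ex_pseries b z).
  { intros b Hb. now apply CV_radius_inside. }
  assert (Hs : forall y b, Rbar_lt (Rabs z) (CV_radius b) ->
    ex_pseries (PS_scal y b) z).
  { intros y b Hb. apply (ex_pseries_scal (V := R_NormedModule)); auto.
    apply Rmult_comm. }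
  assert (Hp := ex_pseries_plus (V := R_NormedModule) _ _ z
    (Hs (2 * g) _ Hr1) (Hs (g ^ 2) _ Hr)).
  rewrite <- !PSeries_scal, <- !PSeries_plus.
  1: { apply PSeries_ext. intros n.
    change (INR (S n) * th a (S n)
      = th (th a) n + (2 * g * th a n + g ^ 2 * a n)).
    rewrite !Hth. unfold a. rewrite hcoef_S. ring. }
  all: auto. }
assert (Hval2 : PSeries (th (th a)) z = z * PSeries (PS_derive (th a)) z)
  by apply Hval.
rewrite Hval2, Hder, Hval in Hsum.
change (PSeries (PS_derive a) z) with (hyp_F1 g z) in Hsum.
change (PSeries a z) with (hyp_F g z) in Hsum.
lra.
Qed.

(** What the Riemann function of [w_TT - w_rr = mu / T^2 w] needs: a solution,
    regular at 0, of Legendre's equation [z (1 + z) P'' + (1 + 2 z) P' = mu P].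
    The equation matters on the closed light cone only, that is for [z >= 0];
    a twice differentiable continuation to the whole line frees the kernel
    from conditions on [r]. *)
Definition legendre_profile (mu : R) (P P1 P2 : R -> R) : Prop :=
  P 0 = 1 /\
  (forall z, is_derive P z (P1 z)) /\
  (forall z, is_derive P1 z (P2 z)) /\
  (forall z, continuous P2 z) /\
  (forall z, 0 <= z -> z * (1 + z) * P2 z + (1 + 2 * z) * P1 z = mu * P z).

(** Pfaff's transformation turns the hypergeometric equation into
    Legendre's. *)
Definition pfaff (g z : R) : R := Rpower (1 + z) (- g) * hyp_F g (z / (1 + z)).
Definition pfaff1 (g z : R) : R :=
  Rpower (1 + z) (- g - 1)
  * (- g * hyp_F g (z / (1 + z)) + hyp_F1 g (z / (1 + z)) / (1 + z)).
Definition pfaff2 (g z : R) : R :=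
  Rpower (1 + z) (- g - 2)
  * (g * (g + 1) * hyp_F g (z / (1 + z))
     - 2 * (g + 1) * hyp_F1 g (z / (1 + z)) / (1 + z)
     + hyp_F2 g (z / (1 + z)) / (1 + z) ^ 2).

Lemma pfaff_arg (z : R) : - (1 / 2) < z -> Rabs (z / (1 + z)) < 1.
Proof.
intros hz. rewrite Rabs_div by lra. rewrite (Rabs_pos_eq (1 + z)) by lra.
apply Rmult_lt_reg_r with (1 + z); [lra|].
unfold Rdiv. rewrite Rmult_assoc, Rinv_l by lra.
unfold Rabs; destruct Rcase_abs; lra.
Qed.

Lemma Rpower_minus1 (x e : R) : 0 < x -> Rpower x (e - 1) = Rpower x e / x.
Proof.
intros hx. unfold Rminus. rewrite Rpower_plus, Rpower_Ropp, Rpower_1; auto.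
Qed.

Lemma Rpower_minus2 (x e : R) : 0 < x -> Rpower x (e - 2) = Rpower x e / x ^ 2.
Proof.
intros hx. replace (e - 2) with (e - 1 - 1) by ring.
rewrite !Rpower_minus1 by auto. field. lra.
Qed.

Lemma is_derive_pfaff_arg (z : R) :
  - (1 / 2) < z -> is_derive (fun z => z / (1 + z)) z (/ (1 + z) ^ 2).
Proof. intros hz. auto_derive; [lra|field; lra]. Qed.

Lemma is_derive_Rpower_1 (z e : R) :
  - (1 / 2) < z ->
  is_derive (fun z => Rpower (1 + z) e) z (e * Rpower (1 + z) (e - 1)).
Proof.
intros hz. rewrite Rpower_minus1 by lra. unfold Rpower.
auto_derive; [lra|field; lra].
Qed.

Lemma is_derive_pfaff (g z : R) :
  g <= 1 -> - (1 / 2) < z -> is_derive (pfaff g) z (pfaff1 g z).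
Proof.
intros hg hz. unfold pfaff, pfaff1.
assert (H1 := is_derive_Rpower_1 z (- g) hz).
assert (H2 := is_derive_R_comp (hyp_F g) (fun z => z / (1 + z)) z _ _
  (is_derive_hyp_F g _ hg (pfaff_arg z hz)) (is_derive_pfaff_arg z hz)).
apply (is_derive_R_eq _ _ _ _ (is_derive_R_mult _ _ _ _ _ H1 H2)).
rewrite Rpower_minus1 by lra. field. lra.
Qed.

Lemma is_derive_pfaff1 (g z : R) :
  g <= 1 -> - (1 / 2) < z -> is_derive (pfaff1 g) z (pfaff2 g z).
Proof.
intros hg hz. unfold pfaff1, pfaff2.
assert (H1 := is_derive_Rpower_1 z (- g - 1) hz).
assert (H2 := is_derive_R_comp (hyp_F g) (fun z => z / (1 + z)) z _ _
  (is_derive_hyp_F g _ hg (pfaff_arg z hz)) (is_derive_pfaff_arg z hz)).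
assert (H3 := is_derive_R_comp (hyp_F1 g) (fun z => z / (1 + z)) z _ _
  (is_derive_hyp_F1 g _ hg (pfaff_arg z hz)) (is_derive_pfaff_arg z hz)).
assert (H4 : is_derive (fun z => / (1 + z)) z (- / (1 + z) ^ 2)).
{ auto_derive; [lra|field; lra]. }
assert (H5 := is_derive_R_mult _ _ _ _ _ H3 H4).
assert (H6 := is_derive_R_plus _ _ _ _ _ (is_derive_R_scal _ _ (- g) _ H2) H5).
apply (is_derive_R_eq _ _ _ _ (is_derive_R_mult _ _ _ _ _ H1 H6)).
rewrite !Rpower_minus1, Rpower_minus2 by lra. field. lra.
Qed.

Lemma continuous_pfaff2 (g z : R) :
  g <= 1 -> - (1 / 2) < z -> continuous (pfaff2 g) z.
Proof.
intros hg hz. assert (Ha := pfaff_arg z hz).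
assert (H2 := is_derive_hyp_F g _ hg Ha).
assert (H3 := is_derive_hyp_F1 g _ hg Ha).
assert (H4 := is_derive_hyp_F2 g _ hg Ha).
apply (ex_derive_continuous (K := R_AbsRing) (V := R_NormedModule)).
unfold pfaff2, Rpower. auto_derive.
repeat split; try lra; try nra.
- now exists (hyp_F1 g (z / (1 + z))).
- now exists (hyp_F2 g (z / (1 + z))).
- now exists (hyp_F3 g (z / (1 + z))).
Qed.

Lemma pfaff_ode (g z : R) :
  g <= 1 -> - (1 / 2) < z ->
  z * (1 + z) * pfaff2 g z + (1 + 2 * z) * pfaff1 g z = g * (g - 1) * pfaff g z.
Proof.
intros hg hz.
assert (H := hyp_F_ode g _ hg (pfaff_arg z hz)).
unfold pfaff, pfaff1, pfaff2. rewrite Rpower_minus1, Rpower_minus2 by lra.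
set (p := Rpower (1 + z) (- g)). set (x := z / (1 + z)) in *.
set (F := hyp_F g x) in *. set (F1 := hyp_F1 g x) in *. set (F2 := hyp_F2 g x) in *.
assert (H' : z * F2 = (1 + z) ^ 2 * (g ^ 2 * F - (1 - (1 + 2 * g) * x) * F1)).
{ rewrite <- H. unfold x. field. lra. }
replace (z * (1 + z) * (p / (1 + z) ^ 2 *
   (g * (g + 1) * F - 2 * (g + 1) * F1 / (1 + z) + F2 / (1 + z) ^ 2)))
 with (p / (1 + z) * (z * (g * (g + 1) * F - 2 * (g + 1) * F1 / (1 + z))
   + (z * F2) / (1 + z) ^ 2)) by (field; lra).
rewrite H'. unfold x. field. lra.
Qed.

(** The continuation to negative arguments freezes the second derivative at
    its value at 0 and integrates twice. *)
Lemma legendre_profile_exists (g : R) :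
  g <= 1 ->
  exists P P1 P2, legendre_profile (g * (g - 1)) P P1 P2 /\
    forall z, 0 <= z -> P z = pfaff g z.
Proof.
intros hg.
set (P2 := fun z => pfaff2 g (Rmax z 0)).
assert (C2 : forall z, continuous P2 z).
{ intros z. unfold P2. apply (continuous_comp (fun z => Rmax z 0)).
  - apply cont_Rmax, continuous_id.
  - apply continuous_pfaff2; [exact hg|]. assert (H := Rmax_r z 0). lra. }
assert (Hint : forall f : R -> R, (forall z, continuous f z) ->
  forall y0 z, is_derive (fun z => y0 + RInt f 0 z) z (f z)).
{ intros f Hf y0 z.
  evar_last.
  - apply (is_derive_plus (V := R_NormedModule)); [apply is_derive_const|].
    apply (is_derive_RInt f _ 0); [|apply Hf].
    apply filter_forall. intros b.
    apply (RInt_correct (V := R_CompleteNormedModule)).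
    apply (ex_RInt_continuous (V := R_CompleteNormedModule)). auto.
  - apply plus_zero_l. }
set (P1 := fun z => pfaff1 g 0 + RInt P2 0 z).
set (P := fun z => pfaff g 0 + RInt P1 0 z).
assert (D1 : forall z, is_derive P1 z (P2 z)) by (intros z; now apply Hint).
assert (C1 : forall z, continuous P1 z).
{ intros z. apply (ex_derive_continuous (K := R_AbsRing) (V := R_NormedModule)).
  now exists (P2 z). }
assert (D0 : forall z, is_derive P z (P1 z)) by (intros z; now apply Hint).
assert (E2 : forall z, 0 <= z -> P2 z = pfaff2 g z).
{ intros z hz. unfold P2. now rewrite Rmax_left. }
assert (Hftc : forall (f df : R -> R) z, 0 <= z ->
  (forall t, 0 <= t -> is_derive f t (df t)) ->
  (forall t, 0 <= t -> continuous df t) -> f 0 + RInt df 0 z = f z).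
{ intros f df z hz Hd Hc.
  assert (HI : is_RInt df 0 z (minus (f z) (f 0))).
  { apply (is_RInt_derive (V := R_CompleteNormedModule));
      rewrite Rmin_left, Rmax_right by lra; intros t Ht; [apply Hd|apply Hc]; lra. }
  rewrite (is_RInt_unique _ _ _ _ HI). unfold minus, plus, opp; simpl. ring. }
assert (E1 : forall z, 0 <= z -> P1 z = pfaff1 g z).
{ intros z hz. unfold P1. rewrite <- (Hftc (pfaff1 g) (pfaff2 g) z hz).
  - f_equal. apply RInt_R_ext. intros t.
    rewrite Rmin_left, Rmax_right by lra. intros Ht. apply E2; lra.
  - intros t ht. apply is_derive_pfaff1; lra.
  - intros t ht. apply continuous_pfaff2; lra. }
assert (E0 : forall z, 0 <= z -> P z = pfaff g z).
{ intros z hz. unfold P. rewrite <- (Hftc (pfaff g) (pfaff1 g) z hz).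
  - f_equal. apply RInt_R_ext. intros t.
    rewrite Rmin_left, Rmax_right by lra. intros Ht. apply E1; lra.
  - intros t ht. apply is_derive_pfaff; lra.
  - intros t ht. apply (ex_derive_continuous (K := R_AbsRing) (V := R_NormedModule)).
    exists (pfaff2 g t). apply is_derive_pfaff1; lra. }
exists P, P1, P2. split; [split; [|split; [|split; [|split]]]|]; auto.
- rewrite E0 by lra. unfold pfaff, hyp_F.
  replace (0 / (1 + 0)) with 0 by field. rewrite PSeries_0.
  unfold hcoef, Rpower. simpl. rewrite Rplus_0_r, ln_1, Rmult_0_r, exp_0. field.
- intros z hz. rewrite E0, E1, E2 by lra. apply pfaff_ode; lra.
Qed.

(** * The Riemann function *)

(** Up to sign the argument [x] of [F (gamma, 1 - gamma; 1; x)] in the Riemann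
    function of the Euler-Poisson-Darboux equation; it vanishes on the light
    cone and is positive inside. *)
Definition zeta (T B r : R) : R := ((T - B) ^ 2 - r ^ 2) / (4 * T * B).
Definition zeta_T (T B r : R) : R := (T ^ 2 - B ^ 2 + r ^ 2) / (4 * T ^ 2 * B).
Definition zeta_r (T B r : R) : R := - r / (2 * T * B).
Definition zeta_TT (T B r : R) : R := (B ^ 2 - r ^ 2) / (2 * T ^ 3 * B).
Definition zeta_rr (T B : R) : R := - 1 / (2 * T * B).

Definition kern (P : R -> R) (T B r : R) : R := / 2 * P (zeta T B r).
Definition kern_T (P1 : R -> R) (T B r : R) : R :=
  / 2 * (P1 (zeta T B r) * zeta_T T B r).
Definition kern_r (P1 : R -> R) (T B r : R) : R :=
  / 2 * (P1 (zeta T B r) * zeta_r T B r).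
Definition kern_TT (P1 P2 : R -> R) (T B r : R) : R :=
  / 2 * (P2 (zeta T B r) * zeta_T T B r ^ 2 + P1 (zeta T B r) * zeta_TT T B r).
Definition kern_rr (P1 P2 : R -> R) (T B r : R) : R :=
  / 2 * (P2 (zeta T B r) * zeta_r T B r ^ 2 + P1 (zeta T B r) * zeta_rr T B).

Lemma is_derive_zeta_T (T B r : R) :
  0 < T -> 0 < B -> is_derive (fun T => zeta T B r) T (zeta_T T B r).
Proof.
intros hT hB. unfold zeta, zeta_T. auto_derive; [nra|field; lra].
Qed.

Lemma is_derive_zeta_r (T B r : R) :
  0 < T -> 0 < B -> is_derive (fun r => zeta T B r) r (zeta_r T B r).
Proof.
intros hT hB. unfold zeta, zeta_r. auto_derive; [trivial|field; lra].
Qed.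

Lemma is_derive_zeta_TT (T B r : R) :
  0 < T -> 0 < B -> is_derive (fun T => zeta_T T B r) T (zeta_TT T B r).
Proof.
intros hT hB. unfold zeta_T, zeta_TT.
assert (0 < T * T) by nra. assert (0 < T * T * B) by nra.
auto_derive; [nra|field; lra].
Qed.

Lemma is_derive_zeta_rr (T B r : R) :
  0 < T -> 0 < B -> is_derive (fun r => zeta_r T B r) r (zeta_rr T B).
Proof.
intros hT hB. unfold zeta_r, zeta_rr. auto_derive; [trivial|field; lra].
Qed.

Lemma zeta_sym (T B r : R) : zeta T B r = zeta B T r.
Proof.
unfold zeta. replace (4 * T * B) with (4 * B * T) by ring. f_equal. ring.
Qed.

Lemma zeta_nonneg (T B r : R) :
  0 < T -> 0 < B -> r ^ 2 <= (T - B) ^ 2 -> 0 <= zeta T B r.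
Proof.
intros hT hB hr. unfold zeta, Rdiv. apply Rmult_le_pos; [lra|].
left. apply Rinv_0_lt_compat. nra.
Qed.

Lemma zeta_cone (T B : R) : zeta T B (T - B) = 0.
Proof. unfold zeta, Rdiv. ring. Qed.

Lemma kern_sym (P : R -> R) (T B r : R) : kern P T B r = kern P B T r.
Proof. unfold kern. now rewrite zeta_sym. Qed.

Section Derivatives.

Variables (mu : R) (P P1 P2 : R -> R).
Hypothesis HP : legendre_profile mu P P1 P2.

Lemma is_derive_kern_T (T B r : R) :
  0 < T -> 0 < B -> is_derive (fun T => kern P T B r) T (kern_T P1 T B r).
Proof.
intros hT hB. unfold kern, kern_T. apply is_derive_R_scal.
apply is_derive_R_comp; [apply HP|now apply is_derive_zeta_T].
Qed.

Lemma is_derive_kern_r (T B r : R) :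
  0 < T -> 0 < B -> is_derive (fun r => kern P T B r) r (kern_r P1 T B r).
Proof.
intros hT hB. unfold kern, kern_r. apply is_derive_R_scal.
apply is_derive_R_comp; [apply HP|now apply is_derive_zeta_r].
Qed.

Lemma is_derive_kern_TT (T B r : R) :
  0 < T -> 0 < B ->
  is_derive (fun T => kern_T P1 T B r) T (kern_TT P1 P2 T B r).
Proof.
intros hT hB. unfold kern_T, kern_TT. apply is_derive_R_scal.
assert (H := is_derive_zeta_T T B r hT hB).
assert (H1 : is_derive (fun T => P1 (zeta T B r)) T (P2 (zeta T B r) * zeta_T T B r)).
{ apply is_derive_R_comp; [apply HP|exact H]. }
apply (is_derive_R_eq _ _ _ _
  (is_derive_R_mult _ _ _ _ _ H1 (is_derive_zeta_TT T B r hT hB))).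
ring.
Qed.

Lemma is_derive_kern_rr (T B r : R) :
  0 < T -> 0 < B ->
  is_derive (fun r => kern_r P1 T B r) r (kern_rr P1 P2 T B r).
Proof.
intros hT hB. unfold kern_r, kern_rr. apply is_derive_R_scal.
assert (H := is_derive_zeta_r T B r hT hB).
assert (H1 : is_derive (fun r => P1 (zeta T B r)) r (P2 (zeta T B r) * zeta_r T B r)).
{ apply is_derive_R_comp; [apply HP|exact H]. }
apply (is_derive_R_eq _ _ _ _
  (is_derive_R_mult _ _ _ _ _ H1 (is_derive_zeta_rr T B r hT hB))).
ring.
Qed.

(** Since [zeta] is symmetric in the two times, the derivatives in [B] are
    those in [T] with the times exchanged. *)
Lemma is_derive_kern_B (T B r : R) :
  0 < T -> 0 < B -> is_derive (fun B => kern P T B r) B (kern_T P1 B T r).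
Proof.
intros hT hB. apply is_derive_ext with (fun B => kern P B T r).
- intros t. apply kern_sym.
- now apply is_derive_kern_T.
Qed.

(** [zeta] turns the wave operator into Legendre's through
    [zeta_T^2 - zeta_r^2 = zeta (1 + zeta) / T^2] and
    [zeta_TT - zeta_rr = (1 + 2 zeta) / T^2]. *)
Lemma kern_equation (T B r : R) :
  0 < T -> 0 < B -> r ^ 2 <= (T - B) ^ 2 ->
  kern_TT P1 P2 T B r - kern_rr P1 P2 T B r = mu / T ^ 2 * kern P T B r.
Proof.
intros hT hB hr.
destruct HP as (_ & _ & _ & _ & Hode).
assert (H := Hode _ (zeta_nonneg T B r hT hB hr)).
unfold kern_TT, kern_rr, kern.
assert (E1 : zeta_T T B r ^ 2 - zeta_r T B r ^ 2
   = zeta T B r * (1 + zeta T B r) / T ^ 2).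
{ unfold zeta_T, zeta_r, zeta. field. lra. }
assert (E2 : zeta_TT T B r - zeta_rr T B = (1 + 2 * zeta T B r) / T ^ 2).
{ unfold zeta_TT, zeta_rr, zeta. field. lra. }
transitivity (/ 2 * (P2 (zeta T B r) * (zeta_T T B r ^ 2 - zeta_r T B r ^ 2)
  + P1 (zeta T B r) * (zeta_TT T B r - zeta_rr T B))); [ring|].
rewrite E1, E2.
transitivity (/ 2 * / T ^ 2 * (mu * P (zeta T B r))); [rewrite <- H|]; field; lra.
Qed.

Lemma kern_equation_B (T B r : R) :
  0 < T -> 0 < B -> r ^ 2 <= (T - B) ^ 2 ->
  kern_TT P1 P2 B T r - kern_rr P1 P2 T B r = mu / B ^ 2 * kern P T B r.
Proof.
intros hT hB hr. rewrite kern_sym, <- (kern_equation B T r); auto.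
- f_equal. unfold kern_rr. rewrite (zeta_sym B T r). unfold zeta_r, zeta_rr.
  now replace (2 * B * T) with (2 * T * B) by ring.
- replace ((B - T) ^ 2) with ((T - B) ^ 2) by ring. exact hr.
Qed.

Lemma kern_cone (T B : R) : kern P T B (T - B) = / 2.
Proof.
unfold kern. rewrite zeta_cone. destruct HP as (-> & _). ring.
Qed.

(** The derivative of the constant value on the cone, in its direction. *)
Lemma kern_cone_T (T B : R) :
  0 < T -> 0 < B -> kern_T P1 T B (T - B) + kern_r P1 T B (T - B) = 0.
Proof.
intros hT hB. unfold kern_T, kern_r, zeta_T, zeta_r. field. lra.
Qed.

Lemma kern_cone_B (T B : R) :
  0 < T -> 0 < B -> kern_T P1 B T (T - B) = kern_r P1 T B (T - B).
Proof.
intros hT hB. unfold kern_T, kern_r. rewrite (zeta_sym B T).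
unfold zeta_T, zeta_r. field. lra.
Qed.

Lemma kern_r_0 (T B : R) : kern_r P1 T B 0 = 0.
Proof. unfold kern_r, zeta_r, Rdiv. ring. Qed.

Section Continuity.

Variables (U : UniformSpace) (T B r : U -> R) (p : U).
Hypotheses (hT : continuous T p) (hB : continuous B p) (hr : continuous r p)
  (T0 : 0 < T p) (B0 : 0 < B p).

Lemma cont_zeta : continuous (fun q => zeta (T q) (B q) (r q)) p.
Proof.
unfold zeta, Rdiv. apply cont_mult; [repeat cont_step|].
apply cont_inv; [repeat cont_step|]. nra.
Qed.

Lemma cont_zeta_T : continuous (fun q => zeta_T (T q) (B q) (r q)) p.
Proof.
unfold zeta_T, Rdiv. apply cont_mult; [repeat cont_step|].
apply cont_inv; [repeat cont_step|].
assert (0 < T p ^ 2) by nra. nra.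
Qed.

Lemma cont_zeta_r : continuous (fun q => zeta_r (T q) (B q) (r q)) p.
Proof.
unfold zeta_r, Rdiv. apply cont_mult; [repeat cont_step|].
apply cont_inv; [repeat cont_step|]. nra.
Qed.

Lemma cont_zeta_TT : continuous (fun q => zeta_TT (T q) (B q) (r q)) p.
Proof.
unfold zeta_TT, Rdiv. apply cont_mult; [repeat cont_step|].
apply cont_inv; [repeat cont_step|].
assert (0 < T p ^ 3) by now apply pow_lt. nra.
Qed.

Lemma cont_zeta_rr : continuous (fun q => zeta_rr (T q) (B q)) p.
Proof.
unfold zeta_rr, Rdiv. apply cont_mult; [repeat cont_step|].
apply cont_inv; [repeat cont_step|]. nra.
Qed.

Lemma cont_profile (f : R -> R) :
  (forall z, continuous f z) ->
  continuous (fun q => f (zeta (T q) (B q) (r q))) p.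
Proof.
intros Hf. apply cont_comp; [apply cont_zeta|apply Hf].
Qed.

Lemma cont_P : forall z, continuous P z.
Proof. intros z. apply is_derive_R_continuous with (P1 z). apply HP. Qed.

Lemma cont_P1 : forall z, continuous P1 z.
Proof. intros z. apply is_derive_R_continuous with (P2 z). apply HP. Qed.

Lemma cont_P2 : forall z, continuous P2 z.
Proof. apply HP. Qed.

Lemma cont_kern : continuous (fun q => kern P (T q) (B q) (r q)) p.
Proof.
apply cont_mult; [apply continuous_const|apply cont_profile, cont_P].
Qed.

Lemma cont_kern_T : continuous (fun q => kern_T P1 (T q) (B q) (r q)) p.
Proof.
apply cont_mult; [apply continuous_const|].
apply cont_mult; [apply cont_profile, cont_P1|apply cont_zeta_T].
Qed.

Lemma cont_kern_r : continuous (fun q => kern_r P1 (T q) (B q) (r q)) p.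
Proof.
apply cont_mult; [apply continuous_const|].
apply cont_mult; [apply cont_profile, cont_P1|apply cont_zeta_r].
Qed.

Lemma cont_kern_TT : continuous (fun q => kern_TT P1 P2 (T q) (B q) (r q)) p.
Proof.
apply cont_mult; [apply continuous_const|].
apply cont_plus; apply cont_mult; try apply cont_pow.
- apply cont_profile, cont_P2.
- apply cont_zeta_T.
- apply cont_profile, cont_P1.
- apply cont_zeta_TT.
Qed.

Lemma cont_kern_rr : continuous (fun q => kern_rr P1 P2 (T q) (B q) (r q)) p.
Proof.
apply cont_mult; [apply continuous_const|].
apply cont_plus; apply cont_mult; try apply cont_pow.
- apply cont_profile, cont_P2.
- apply cont_zeta_r.
- apply cont_profile, cont_P1.
- apply cont_zeta_rr.
Qed.

End Continuity.
End Derivatives.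

(** * Riemann's method *)

Definition cont2 (h : R -> R -> R) (t x : R) : Prop :=
  continuous (fun q : R * R => h (fst q) (snd q)) (t, x).

(** For [s = 1] the even part of [h] around [x], up to a factor 2, and for
    [s = - 1] the odd part; a derivative in [r] exchanges the two. *)
Definition refl_sum (s : R) (h : R -> R) (x r : R) : R := h (x + r) + s * h (x - r).

Lemma is_derive_refl_sum (s : R) (h h' : R -> R) (x r : R) :
  (forall y, is_derive h y (h' y)) ->
  is_derive (fun r => refl_sum s h x r) r (refl_sum (- s) h' x r).
Proof.
intros Hh. unfold refl_sum.
assert (H1 : is_derive (fun r => h (x + r)) r (h' (x + r) * 1)).
{ apply is_derive_R_comp; [apply Hh|]. auto_derive; auto; ring. }
assert (H2 : is_derive (fun r => h (x - r)) r (h' (x - r) * -1)).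
{ apply (is_derive_R_comp h (fun r => x - r)); [apply Hh|]. auto_derive; auto; ring. }
apply (is_derive_R_eq _ _ _ _
  (is_derive_R_plus _ _ _ _ _ H1 (is_derive_R_scal _ _ s _ H2))).
ring.
Qed.

Lemma is_derive_refl_sum_param (s : R) (h h' : R -> R -> R) (x r t : R) :
  (forall y, is_derive (fun t => h t y) t (h' t y)) ->
  is_derive (fun t => refl_sum s (h t) x r) t (refl_sum s (h' t) x r).
Proof.
intros Hh. apply is_derive_R_plus; [|apply is_derive_R_scal]; apply Hh.
Qed.

Lemma is_derive_refl_sum_center (s : R) (h h' : R -> R) (x r : R) :
  (forall y, is_derive h y (h' y)) ->
  is_derive (fun x => refl_sum s h x r) x (refl_sum s h' x r).
Proof.
intros Hh. unfold refl_sum.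
assert (H1 : is_derive (fun x => h (x + r)) x (h' (x + r) * 1)).
{ apply (is_derive_R_comp h (fun x => x + r)); [apply Hh|]. auto_derive; auto; ring. }
assert (H2 : is_derive (fun x => h (x - r)) x (h' (x - r) * 1)).
{ apply (is_derive_R_comp h (fun x => x - r)); [apply Hh|]. auto_derive; auto; ring. }
apply (is_derive_R_eq _ _ _ _
  (is_derive_R_plus _ _ _ _ _ H1 (is_derive_R_scal _ _ s _ H2))).
ring.
Qed.

Lemma cont_refl_sum {U : UniformSpace} (s : R) (h : R -> R -> R) (t x r : U -> R)
  (p : U) :
  continuous t p -> continuous x p -> continuous r p ->
  (forall y, cont2 h (t p) y) ->
  continuous (fun q => refl_sum s (h (t q)) (x q) (r q)) p.
Proof.
intros Ht Hx Hr Hh. unfold refl_sum.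
apply cont_plus; [|apply cont_mult; [apply continuous_const|]].
- apply (cont_comp_2 h t (fun q => x q + r q)); [exact Ht| |apply Hh].
  now apply cont_plus.
- apply (cont_comp_2 h t (fun q => x q - r q)); [exact Ht| |apply Hh].
  now apply cont_minus.
Qed.

(** Joint continuity of the time derivative makes [h] differentiable in both
    variables together, hence along a curve. *)
Lemma is_derive_along (h ht : R -> R -> R) (b : R -> R) (t hy db : R) :
  locally t (fun t => forall y, is_derive (fun t => h t y) t (ht t y)) ->
  cont2 ht t (b t) ->
  is_derive (fun y => h t y) (b t) hy ->
  is_derive b t db ->
  is_derive (fun t => h t (b t)) t (ht t (b t) + hy * db).
Proof.
intros Hloc Hc Hy Hb.
assert (Hf := is_derive_filterdiff h t (b t) ht hy).
assert (Hl : locally (t, b t) (fun u : R * R =>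
  is_derive (fun z => h z (snd u)) (fst u) (ht (fst u) (snd u)))).
{ destruct Hloc as [e He]. exists e. intros [u v] [Hu _]; simpl in *.
  now apply He. }
specialize (Hf Hl Hy Hc).
unfold is_derive. eapply filterdiff_ext_lin.
- exact (filterdiff_comp'_2 (fun t : R_NormedModule => t) b h t (fun y => y) _
    (fun u v => plus (scal u (ht t (b t))) (scal v hy)) (filterdiff_id _) Hb Hf).
- intros y. unfold plus, scal; simpl; unfold mult; simpl. ring.
Qed.

(** The antiderivative of [h'' k - h k''] is [h' k - h k']. *)
Lemma RInt_green (h h1 h2 k k1 k2 : R -> R) (a b : R) :
  (forall r, is_derive h r (h1 r)) -> (forall r, is_derive h1 r (h2 r)) ->
  (forall r, is_derive k r (k1 r)) -> (forall r, is_derive k1 r (k2 r)) ->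
  (forall r, continuous h2 r) -> (forall r, continuous k2 r) ->
  RInt (fun r => h2 r * k r - h r * k2 r) a b
  = (h1 b * k b - h b * k1 b) - (h1 a * k a - h a * k1 a).
Proof.
intros H0 H1 K0 K1 C2 CK2.
apply (RInt_R_derive (fun r => h1 r * k r - h r * k1 r)).
- intros r _.
  apply (is_derive_R_eq _ _ _ _ (is_derive_R_plus _ _ _ _ _
    (is_derive_R_mult _ _ _ _ _ (H1 r) (K0 r))
    (is_derive_opp _ _ _ (is_derive_R_mult _ _ _ _ _ (H0 r) (K1 r))))).
  unfold opp; simpl. ring.
- intros r _.
  assert (Ch := is_derive_R_continuous _ _ _ (H0 r)).
  assert (Ck := is_derive_R_continuous _ _ _ (K0 r)).
  assert (C2r := C2 r). assert (CK2r := CK2 r).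
  repeat cont_step.
Qed.

Section Riemann.

Variables (mu : R) (P P1 P2 : R -> R).
Hypothesis HP : legendre_profile mu P P1 P2.
Variables (T0 : R) (f w wB wBB wy wyy : R -> R -> R).
Hypothesis HT0 : 0 < T0.
Hypothesis Cf : forall B y, cont2 f B y.
Hypothesis Cw : forall B y, cont2 w B y.
Hypothesis CwB : forall B y, cont2 wB B y.
Hypothesis CwBB : forall B y, T0 < B -> cont2 wBB B y.
Hypothesis Cwyy : forall B y, T0 < B -> cont2 wyy B y.
Hypothesis DB : forall B y, T0 < B -> is_derive (fun B => w B y) B (wB B y).
Hypothesis DBB : forall B y, T0 < B -> is_derive (fun B => wB B y) B (wBB B y).
Hypothesis Dy : forall B y, T0 < B -> is_derive (w B) y (wy B y).
Hypothesis Dyy : forall B y, T0 < B -> is_derive (wy B) y (wyy B y).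
Hypothesis Heq : forall B y, T0 < B ->
  wBB B y - wyy B y = mu / B ^ 2 * w B y + f B y.

Definition riemann_flux (T x B r : R) : R :=
  refl_sum 1 (wB B) x r * kern P T B r - refl_sum 1 (w B) x r * kern_T P1 B T r.

(** By Green's identity on the part of the backward cone between two times,
    the difference of the two values is an integral of the source. *)
Definition riemann_functional (T x B : R) : R :=
  RInt (fun r => riemann_flux T x B r) 0 (T - B) + / 2 * refl_sum 1 (w B) x (T - B).

Lemma cont_riemann_flux (T x B r : R) :
  0 < T -> 0 < B -> cont2 (riemann_flux T x) B r.
Proof.
intros hT hB. unfold cont2, riemann_flux.
assert (C1 : continuous (fun q : R * R => fst q) (B, r)) by apply continuous_fst.
assert (C2 : continuous (fun q : R * R => snd q) (B, r)) by apply continuous_snd.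
assert (C3 : continuous (fun _ : R * R => T) (B, r)) by apply continuous_const.
assert (C4 : continuous (fun _ : R * R => x) (B, r)) by apply continuous_const.
apply cont_minus; apply cont_mult.
- apply (cont_refl_sum 1 wB (fun q : R * R => fst q) (fun _ => x) (fun q => snd q)); auto.
- apply (cont_kern mu P P1 P2 HP _ (fun _ => T) (fun q : R * R => fst q)
    (fun q => snd q)); auto.
- apply (cont_refl_sum 1 w (fun q : R * R => fst q) (fun _ => x) (fun q => snd q)); auto.
- apply (cont_kern_T mu P P1 P2 HP _ (fun q : R * R => fst q) (fun _ => T)
    (fun q => snd q)); auto.
Qed.

Lemma cont_riemann_functional (T x B : R) :
  0 < T -> 0 < B -> continuous (riemann_functional T x) B.
Proof.
intros hT hB. unfold riemann_functional.
assert (C5 : continuous (fun B : R => T - B) B).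
{ apply cont_minus; [apply continuous_const|apply continuous_id]. }
apply cont_plus.
- apply (continuous_RInt_upper (fun B r => riemann_flux T x B r) 0
    (fun B => T - B)); [exact C5|].
  apply locally_open with (D := fun B => 0 < B); auto.
  + apply open_gt.
  + intros B' hB' r. now apply cont_riemann_flux.
- apply cont_mult; [apply continuous_const|].
  apply (cont_refl_sum 1 w (fun B : R => B) (fun _ => x) (fun B => T - B)); auto.
  + apply continuous_id.
  + apply continuous_const.
Qed.

(** Riemann's method: differentiation of the functional in [B] leaves only the
    source, because the integrand is a divergence up to the source and the
    kernel is constant on the characteristics. *)
Lemma is_derive_riemann_functional (T x B : R) :
  T0 < B -> B <= T ->
  is_derive (riemann_functional T x) B
    (RInt (fun r => refl_sum 1 (f B) x r * kern P T B r) 0 (T - B)).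
Proof.
intros hB hBT.
assert (hB0 : 0 < B) by lra. assert (hT : 0 < T) by lra.
set (flux' := fun B r =>
  refl_sum 1 (wBB B) x r * kern P T B r - refl_sum 1 (w B) x r * kern_TT P1 P2 B T r).
assert (Dop : open (fun B => T0 < B)) by apply open_gt.
assert (Dd : is_derive (fun B => T - B) B (- 1)) by (auto_derive; auto; ring).
assert (H1 : is_derive (fun B => RInt (fun r => riemann_flux T x B r) 0 (T - B)) B
  (RInt (fun r => flux' B r) 0 (T - B) + riemann_flux T x B (T - B) * - 1)).
{ apply (is_derive_RInt_upper (riemann_flux T x) flux' (fun B => T0 < B)); auto.
  - intros t r ht.
    assert (E1 : is_derive (fun B => refl_sum 1 (wB B) x r) t (refl_sum 1 (wBB t) x r)).
    { apply is_derive_refl_sum_param. intros y. now apply DBB. }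
    assert (E2 : is_derive (fun B => refl_sum 1 (w B) x r) t (refl_sum 1 (wB t) x r)).
    { apply is_derive_refl_sum_param. intros y. now apply DB. }
    assert (E3 := is_derive_kern_B mu P P1 P2 HP T t r hT ltac:(lra)).
    assert (E4 := is_derive_kern_TT mu P P1 P2 HP t T r ltac:(lra) hT).
    apply (is_derive_R_eq _ _ _ _ (is_derive_R_plus _ _ _ _ _
      (is_derive_R_mult _ _ _ _ _ E1 E3)
      (is_derive_opp _ _ _ (is_derive_R_mult _ _ _ _ _ E2 E4)))).
    unfold flux', opp; simpl. ring.
  - intros t r ht.
    apply (cont_comp_2 (riemann_flux T x) (fun _ => t) (fun r => r)).
    + apply continuous_const.
    + apply continuous_id.
    + apply cont_riemann_flux; lra.
  - intros t r ht. unfold flux'.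
    assert (C1 : continuous (fun q : R * R => fst q) (t, r)) by apply continuous_fst.
    assert (C2 : continuous (fun q : R * R => snd q) (t, r)) by apply continuous_snd.
    assert (C3 : continuous (fun _ : R * R => T) (t, r)) by apply continuous_const.
    assert (C4 : continuous (fun _ : R * R => x) (t, r)) by apply continuous_const.
    assert (0 < t) by lra.
    apply cont_minus; apply cont_mult.
    + apply (cont_refl_sum 1 wBB (fun q : R * R => fst q) (fun _ => x) (fun q => snd q)); auto.
    + apply (cont_kern mu P P1 P2 HP _ (fun _ => T) (fun q : R * R => fst q)
        (fun q => snd q)); auto.
    + apply (cont_refl_sum 1 w (fun q : R * R => fst q) (fun _ => x) (fun q => snd q)); auto.
    + apply (cont_kern_TT mu P P1 P2 HP _ (fun q : R * R => fst q) (fun _ => T)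
        (fun q => snd q)); auto. }
assert (Hl : locally B (fun B => forall y, is_derive (fun B => w B y) B (wB B y))).
{ apply locally_open with (D := fun B => T0 < B); auto. }
assert (A1 : is_derive (fun B => w B (x + (T - B))) B
   (wB B (x + (T - B)) + wy B (x + (T - B)) * - 1)).
{ apply (is_derive_along w wB (fun B => x + (T - B))); auto.
  auto_derive; auto; ring. }
assert (A2 : is_derive (fun B => w B (x - (T - B))) B
   (wB B (x - (T - B)) + wy B (x - (T - B)) * 1)).
{ apply (is_derive_along w wB (fun B => x - (T - B))); auto.
  auto_derive; auto; ring. }
assert (H2 := is_derive_R_scal _ _ (/ 2) _
  (is_derive_R_plus _ _ _ _ _ A1 (is_derive_R_scal _ _ 1 _ A2))).
apply (is_derive_R_eq _ _ _ _ (is_derive_R_plus _ _ _ _ _ H1 H2)).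
assert (Ck : forall r, continuous (fun r => kern P T B r) r).
{ intros r. apply is_derive_R_continuous with (kern_r P1 T B r).
  now apply is_derive_kern_r with mu P2. }
assert (Crefl : forall s h, (forall y, cont2 h B y) ->
  forall r, continuous (fun r => refl_sum s (h B) x r) r).
{ intros s h Hh r. apply (cont_refl_sum s h (fun _ => B) (fun _ => x) (fun r => r)); auto.
  - apply continuous_const.
  - apply continuous_const.
  - apply continuous_id. }
assert (Ckrr : forall r, continuous (fun r => kern_rr P1 P2 T B r) r).
{ intros r. apply (cont_kern_rr mu P P1 P2 HP _ (fun _ => T) (fun _ => B) (fun r => r)); auto.
  - apply continuous_const.
  - apply continuous_const.
  - apply continuous_id. }
assert (Hsplit : RInt (fun r => flux' B r) 0 (T - B)
  = RInt (fun r => refl_sum 1 (wyy B) x r * kern P T B r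
       - refl_sum 1 (w B) x r * kern_rr P1 P2 T B r) 0 (T - B)
    + RInt (fun r => refl_sum 1 (f B) x r * kern P T B r) 0 (T - B)).
{ rewrite <- RInt_R_plus.
  - apply RInt_R_ext. intros r. rewrite Rmin_left, Rmax_right by lra. intros Hr.
    unfold flux'.
    assert (Hk := kern_equation_B mu P P1 P2 HP T B r hT hB0 ltac:(nra)).
    replace (kern_TT P1 P2 B T r)
      with (kern_rr P1 P2 T B r + mu / B ^ 2 * kern P T B r) by lra.
    assert (Hw : forall y, wBB B y = wyy B y + mu / B ^ 2 * w B y + f B y).
    { intros y. assert (H := Heq B y hB). lra. }
    unfold refl_sum. rewrite !Hw. ring.
  - apply ex_RInt_R. intros r. apply cont_minus; apply cont_mult; auto.
  - apply ex_RInt_R. intros r. apply cont_mult; auto. }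
rewrite Hsplit.
rewrite (RInt_green (fun r => refl_sum 1 (w B) x r) (fun r => refl_sum (- 1) (wy B) x r)
  (fun r => refl_sum 1 (wyy B) x r) (fun r => kern P T B r) (fun r => kern_r P1 T B r)
  (fun r => kern_rr P1 P2 T B r)).
- unfold riemann_flux. rewrite (kern_cone mu P P1 P2 HP), kern_r_0,
    (kern_cone_B P1 T B hT hB0).
  unfold refl_sum. rewrite Rplus_0_r, Rminus_0_r. field.
- intros r. apply is_derive_refl_sum. auto.
- intros r. replace 1 with (- - 1) by ring. apply is_derive_refl_sum. auto.
- intros r. now apply is_derive_kern_r with mu P2.
- intros r. now apply is_derive_kern_rr with mu P.
- auto.
- auto.
Qed.

Lemma riemann_functional_apex (T x : R) : riemann_functional T x T = w T x.
Proof.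
unfold riemann_functional, refl_sum. rewrite Rminus_diag, RInt_point.
rewrite Rplus_0_r, Rminus_0_r. unfold zero; simpl. field.
Qed.

End Riemann.

(** * Waves emitted at one time, and their superposition *)

Definition cont3 (V : R -> R -> R -> R) (D : R -> R -> Prop) : Prop :=
  forall (U : UniformSpace) (T x B : U -> R) (p : U),
  continuous T p -> continuous x p -> continuous B p -> D (T p) (B p) ->
  continuous (fun q => V (T q) (x q) (B q)) p.

Definition cont_kernel (k : R -> R -> R -> R) : Prop :=
  forall (U : UniformSpace) (T B r : U -> R) (p : U),
  continuous T p -> continuous B p -> continuous r p ->
  0 < T p -> 0 < B p -> continuous (fun q => k (T q) (B q) (r q)) p.

Definition pos2 (T B : R) : Prop := 0 < T /\ 0 < B.

(** The contribution of the slice of the backward cone of [(T, x)] at time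
    [B], with density [h] and kernel [k]. *)
Definition layer (s : R) (h : R -> R -> R) (k : R -> R -> R -> R)
  (T x B : R) : R :=
  RInt (fun r => refl_sum s (h B) x r * k T B r) 0 (T - B).

Lemma cont_layer_integrand (s : R) (h : R -> R -> R) (k : R -> R -> R -> R)
  {U : UniformSpace} (T x B r : U -> R) (p : U) :
  (forall t y, cont2 h t y) -> cont_kernel k ->
  continuous T p -> continuous x p -> continuous B p -> continuous r p ->
  0 < T p -> 0 < B p ->
  continuous (fun q => refl_sum s (h (B q)) (x q) (r q) * k (T q) (B q) (r q)) p.
Proof.
intros Hh Hk HT Hx HB Hr T0 B0. apply cont_mult.
- now apply cont_refl_sum.
- now apply Hk.
Qed.

Lemma cont_pos {U : UniformSpace} (T : U -> R) (p : U) :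
  continuous T p -> 0 < T p -> locally p (fun q => 0 < T q).
Proof.
intros HT H0. apply HT. apply (locally_open (fun t => 0 < t)); auto.
apply open_gt.
Qed.

Lemma cont_fst_comp {U V : UniformSpace} (f : U -> R) (p : U * V) :
  continuous f (fst p) -> continuous (fun q : U * V => f (fst q)) p.
Proof. intros H. apply (continuous_comp fst f); [apply continuous_fst|exact H]. Qed.

(** The functions [T], [x] and [B] are continuous at [p] only, whereas a
    continuous integral asks for a continuous integrand at all parameters near
    the given one. Continuity is therefore shown on R^3 and then composed. *)
Lemma cont_layer (s : R) (h : R -> R -> R) (k : R -> R -> R -> R) :
  (forall t y, cont2 h t y) -> cont_kernel k -> cont3 (layer s h k) pos2.
Proof.
intros Hh Hk U T x B p HT Hx HB [T0 B0].
assert (H : continuous (fun z : (R * R) * R =>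
   layer s h k (fst (fst z)) (snd (fst z)) (snd z)) ((T p, x p), B p)).
{ unfold layer.
  apply (continuous_RInt_upper (fun (z : (R * R) * R) r =>
     refl_sum s (h (snd z)) (snd (fst z)) r * k (fst (fst z)) (snd z) r) 0
     (fun z => fst (fst z) - snd z)).
  - apply cont_minus.
    + apply cont_fst_comp, continuous_fst.
    + apply continuous_snd.
  - assert (L1 : locally ((T p, x p), B p) (fun z : (R * R) * R => 0 < fst (fst z))).
    { apply cont_pos; [|exact T0]. apply cont_fst_comp, continuous_fst. }
    assert (L2 : locally ((T p, x p), B p) (fun z : (R * R) * R => 0 < snd z)).
    { apply cont_pos; [|exact B0]. apply continuous_snd. }
    generalize (filter_and _ _ L1 L2). apply filter_imp. intros z [z1 z2] r.
    apply (cont_layer_integrand s h k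
      (fun q : (R * R) * R * R => fst (fst (fst q))) (fun q => snd (fst (fst q)))
      (fun q => snd (fst q)) (fun q => snd q)); auto.
    + apply (cont_fst_comp (fun z : (R * R) * R => fst (fst z))).
      apply (cont_fst_comp fst), continuous_fst.
    + apply (cont_fst_comp (fun z : (R * R) * R => snd (fst z))).
      apply (cont_fst_comp snd), continuous_snd.
    + apply (cont_fst_comp (fun z : (R * R) * R => snd z)), continuous_snd.
    + apply continuous_snd. }
apply (continuous_comp_2 (fun q => (T q, x q)) B
  (fun z b => layer s h k (fst z) (snd z) b)).
- apply (continuous_comp_2 T x (fun t y => (t, y))); auto.
  intros S [e He]. exists e. intros [a b] Hab. now apply He.
- exact HB.
- exact H.
Qed.

Lemma is_derive_layer_T (s : R) (h : R -> R -> R) (k kT : R -> R -> R -> R)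
  (T x B : R) :
  (forall t y, cont2 h t y) -> cont_kernel k -> cont_kernel kT ->
  (forall T B r, 0 < T -> 0 < B -> is_derive (fun T => k T B r) T (kT T B r)) ->
  0 < T -> 0 < B ->
  is_derive (fun T => layer s h k T x B) T
    (layer s h kT T x B + refl_sum s (h B) x (T - B) * k T B (T - B)).
Proof.
intros Hh Hk HkT Hd hT hB. unfold layer.
apply (is_derive_R_eq _ _ (RInt (fun r => refl_sum s (h B) x r * kT T B r) 0 (T - B)
   + refl_sum s (h B) x (T - B) * k T B (T - B) * 1)); [|ring].
apply (is_derive_RInt_upper (fun T r => refl_sum s (h B) x r * k T B r)
  (fun T r => refl_sum s (h B) x r * kT T B r) (fun T => 0 < T) 0 (fun T => T - B)).
- apply open_gt.
- exact hT.
- intros t r ht. exact (is_derive_R_scal (fun T => k T B r) t _ _ (Hd t B r ht hB)).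
- intros t r ht.
  apply (cont_layer_integrand s h k (fun _ => t) (fun _ => x) (fun _ => B)
    (fun r => r)); auto; try apply continuous_const; apply continuous_id.
- intros t r ht.
  apply (cont_layer_integrand s h kT (fun q : R * R => fst q) (fun _ => x)
    (fun _ => B) (fun q => snd q)); auto; try apply continuous_const.
  + apply continuous_fst.
  + apply continuous_snd.
- auto_derive; auto; ring.
Qed.

Lemma is_derive_layer_x (s : R) (h hx : R -> R -> R) (k : R -> R -> R -> R)
  (T x B : R) :
  (forall t y, cont2 h t y) -> (forall t y, cont2 hx t y) -> cont_kernel k ->
  (forall t y, is_derive (h t) y (hx t y)) ->
  0 < T -> 0 < B ->
  is_derive (fun x => layer s h k T x B) x (layer s hx k T x B).
Proof.
intros Hh Hhx Hk Hd hT hB. unfold layer.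
apply (is_derive_R_eq _ _ (RInt (fun r => refl_sum s (hx B) x r * k T B r) 0 (T - B)
   + refl_sum s (h B) x (T - B) * k T B (T - B) * 0)); [|ring].
apply (is_derive_RInt_upper (fun x r => refl_sum s (h B) x r * k T B r)
  (fun x r => refl_sum s (hx B) x r * k T B r) (fun _ => True) 0 (fun _ => T - B)).
- apply open_true.
- trivial.
- intros t r _.
  assert (H := is_derive_R_mult (fun x => refl_sum s (h B) x r) (fun _ => k T B r) t _ _
    (is_derive_refl_sum_center s (h B) (hx B) t r (Hd B)) (is_derive_const _ _)).
  apply (is_derive_R_eq _ _ _ _ H). unfold zero; simpl. ring.
- intros t r _.
  apply (cont_layer_integrand s h k (fun _ => T) (fun _ => t) (fun _ => B)
    (fun r => r)); auto; try apply continuous_const; apply continuous_id.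
- intros t r _.
  apply (cont_layer_integrand s hx k (fun _ => T) (fun q : R * R => fst q)
    (fun _ => B) (fun q => snd q)); auto; try apply continuous_const.
  + apply continuous_fst.
  + apply continuous_snd.
- apply (is_derive_const (V := R_NormedModule)).
Qed.

(** The clamp keeps the integration variable positive without changing the
    integral between times above [e]. *)
Definition superpose (e T0 : R) (V : R -> R -> R -> R) (T x : R) : R :=
  RInt (fun B => V T x (Rmax B e)) T0 T.

Section Superposition.

Variables (e T0 : R) (V : R -> R -> R -> R).
Hypothesis (he : 0 < e) (CV : cont3 V pos2).

Lemma clamp_pos (B : R) : 0 < Rmax B e.
Proof. assert (H := Rmax_r B e). lra. Qed.

Lemma cont_superpose (T x : R) : 0 < T -> cont2 (superpose e T0 V) T x.
Proof.
intros hT. unfold cont2, superpose.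
apply (continuous_RInt_upper (fun (z : R * R) B => V (fst z) (snd z) (Rmax B e)) T0
  (fun z => fst z)).
- apply continuous_fst.
- assert (L : locally (T, x) (fun z : R * R => 0 < fst z)).
  { apply cont_pos; [apply continuous_fst|exact hT]. }
  revert L. apply filter_imp. intros z hz B.
  apply (CV _ (fun q : (R * R) * R => fst (fst q)) (fun q => snd (fst q))
     (fun q => Rmax (snd q) e)).
  + apply (cont_fst_comp fst), continuous_fst.
  + apply (cont_fst_comp snd), continuous_snd.
  + apply cont_Rmax, continuous_snd.
  + split; [exact hz|apply clamp_pos].
Qed.

Lemma is_derive_superpose_T (VT : R -> R -> R -> R) (T x : R) :
  cont3 VT pos2 ->
  (forall T B, 0 < T -> 0 < B -> is_derive (fun T => V T x B) T (VT T x B)) ->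
  e < T ->
  is_derive (fun T => superpose e T0 V T x) T (superpose e T0 VT T x + V T x T).
Proof.
intros CVT Hd hT. unfold superpose.
apply (is_derive_R_eq _ _ (RInt (fun B => VT T x (Rmax B e)) T0 T
   + V T x (Rmax T e) * 1)).
2: rewrite (Rmax_left T) by lra; ring.
apply (is_derive_RInt_upper (fun T B => V T x (Rmax B e))
  (fun T B => VT T x (Rmax B e)) (fun T => 0 < T) T0 (fun T => T)).
- apply open_gt.
- lra.
- intros t B ht. apply Hd; [exact ht|apply clamp_pos].
- intros t B ht.
  apply (CV _ (fun _ => t) (fun _ => x) (fun B => Rmax B e)).
  + apply continuous_const.
  + apply continuous_const.
  + apply cont_Rmax, continuous_id.
  + split; [exact ht|apply clamp_pos].
- intros t B ht.
  apply (CVT _ (fun q : R * R => fst q) (fun _ => x) (fun q => Rmax (snd q) e)).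
  + apply continuous_fst.
  + apply continuous_const.
  + apply cont_Rmax, continuous_snd.
  + split; [exact ht|apply clamp_pos].
- apply (is_derive_id (K := R_AbsRing)).
Qed.

Lemma is_derive_superpose_x (Vx : R -> R -> R -> R) (T x : R) :
  cont3 Vx pos2 ->
  (forall x B, 0 < B -> is_derive (fun x => V T x B) x (Vx T x B)) ->
  e < T ->
  is_derive (fun x => superpose e T0 V T x) x (superpose e T0 Vx T x).
Proof.
intros CVx Hd hT. unfold superpose.
apply (is_derive_R_eq _ _ (RInt (fun B => Vx T x (Rmax B e)) T0 T
   + V T x (Rmax T e) * 0)).
2: ring.
apply (is_derive_RInt_upper (fun x B => V T x (Rmax B e))
  (fun x B => Vx T x (Rmax B e)) (fun _ => True) T0 (fun _ => T)).
- apply open_true.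
- trivial.
- intros t B _. apply Hd, clamp_pos.
- intros t B _.
  apply (CV _ (fun _ => T) (fun _ => t) (fun B => Rmax B e)).
  + apply continuous_const.
  + apply continuous_const.
  + apply cont_Rmax, continuous_id.
  + split; [lra|apply clamp_pos].
- intros t B _.
  apply (CVx _ (fun _ => T) (fun q : R * R => fst q) (fun q => Rmax (snd q) e)).
  + apply continuous_const.
  + apply continuous_fst.
  + apply cont_Rmax, continuous_snd.
  + split; [lra|apply clamp_pos].
- apply (is_derive_const (V := R_NormedModule)).
Qed.

Lemma ex_RInt_superpose (T x a b : R) :
  0 < T -> ex_RInt (fun B => V T x (Rmax B e)) a b.
Proof.
intros hT. apply ex_RInt_R. intros B.
apply (CV _ (fun _ => T) (fun _ => x) (fun B => Rmax B e)).
- apply continuous_const.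
- apply continuous_const.
- apply cont_Rmax, continuous_id.
- split; [lra|apply clamp_pos].
Qed.

End Superposition.

(** * The Cauchy problem for the flattened equation *)

Definition C2_jet (e : R) (w wT wx wTT wTx wxx : R -> R -> R) : Prop :=
  forall T x, e < T ->
  (cont2 w T x /\ cont2 wT T x /\ cont2 wx T x /\
   cont2 wTT T x /\ cont2 wTx T x /\ cont2 wxx T x) /\
  is_derive (fun T => w T x) T (wT T x) /\
  is_derive (w T) x (wx T x) /\
  is_derive (fun T => wT T x) T (wTT T x) /\
  is_derive (wT T) x (wTx T x) /\
  is_derive (fun T => wx T x) T (wTx T x) /\
  is_derive (wx T) x (wxx T x).

Section Duhamel.

Variables (mu : R) (P P1 P2 : R -> R).
Hypothesis HP : legendre_profile mu P P1 P2.
Variables (e T0 : R) (f fx : R -> R -> R).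
Hypothesis he : 0 < e.
Hypotheses (Cf : forall t y, cont2 f t y) (Cfx : forall t y, cont2 fx t y).
Hypothesis Df : forall t y, is_derive (f t) y (fx t y).

Let K := kern P.
Let KT := kern_T P1.
Let Kr := kern_r P1.
Let KTT := kern_TT P1 P2.
Let Krr := kern_rr P1 P2.

Let CK : cont_kernel K := cont_kern mu P P1 P2 HP.
Let CKT : cont_kernel KT := cont_kern_T mu P P1 P2 HP.
Let CKr : cont_kernel Kr := cont_kern_r mu P P1 P2 HP.
Let CKTT : cont_kernel KTT := cont_kern_TT mu P P1 P2 HP.
Let CKrr : cont_kernel Krr := cont_kern_rr mu P P1 P2 HP.

(** The boundary term produced by the moving end point of a slice, with the
    value 1/2 of the kernel on the cone. *)
Definition edge (s : R) (h : R -> R -> R) (T x B : R) : R :=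
  / 2 * refl_sum s (h B) x (T - B).

Lemma cont_edge (s : R) (h : R -> R -> R) :
  (forall t y, cont2 h t y) -> cont3 (edge s h) pos2.
Proof.
intros Hh U T x B p HT Hx HB _. apply cont_mult; [apply continuous_const|].
apply (cont_refl_sum s h B x (fun q => T q - B q)); auto.
now apply cont_minus.
Qed.

Lemma is_derive_edge_T (s : R) (T x B : R) :
  is_derive (fun T => edge s f T x B) T (edge (- s) fx T x B).
Proof.
apply is_derive_R_scal.
apply (is_derive_R_eq _ _ (refl_sum (- s) (fx B) x (T - B) * 1)); [|ring].
apply (is_derive_R_comp (fun r => refl_sum s (f B) x r) (fun T => T - B)).
- apply is_derive_refl_sum, Df.
- auto_derive; auto; ring.
Qed.

Lemma is_derive_edge_x (s : R) (T x B : R) :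
  is_derive (fun x => edge s f T x B) x (edge s fx T x B).
Proof. apply is_derive_R_scal, is_derive_refl_sum_center, Df. Qed.

Definition duhamel := layer 1 f K.
Definition duhamel_T (T x B : R) := layer 1 f KT T x B + edge 1 f T x B.
Definition duhamel_x := layer 1 fx K.
Definition duhamel_TT (T x B : R) :=
  layer 1 f KTT T x B + refl_sum 1 (f B) x (T - B) * KT T B (T - B)
  + edge (- 1) fx T x B.
Definition duhamel_Tx (T x B : R) := layer 1 fx KT T x B + edge 1 fx T x B.
Definition duhamel_xx (T x B : R) := edge (- 1) fx T x B - layer (- 1) fx Kr T x B.

Lemma cont_duhamel : cont3 duhamel pos2.
Proof. now apply cont_layer. Qed.

Lemma cont_duhamel_T : cont3 duhamel_T pos2.
Proof.
intros U T x B p HT Hx HB H. apply cont_plus.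
- now apply (cont_layer 1 f KT Cf CKT).
- now apply (cont_edge 1 f Cf).
Qed.

Lemma cont_duhamel_x : cont3 duhamel_x pos2.
Proof. now apply cont_layer. Qed.

Lemma cont_duhamel_TT : cont3 duhamel_TT pos2.
Proof.
intros U T x B p HT Hx HB H.
assert (Hd : continuous (fun q => T q - B q) p) by now apply cont_minus.
apply cont_plus; [apply cont_plus; [|apply cont_mult]|].
- now apply (cont_layer 1 f KTT Cf CKTT).
- now apply (cont_refl_sum 1 f B x (fun q => T q - B q)).
- now apply (CKT U T B (fun q => T q - B q)); try apply H.
- now apply (cont_edge (- 1) fx Cfx).
Qed.

Lemma cont_duhamel_Tx : cont3 duhamel_Tx pos2.
Proof.
intros U T x B p HT Hx HB H. apply cont_plus.
- now apply (cont_layer 1 fx KT Cfx CKT).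
- now apply (cont_edge 1 fx Cfx).
Qed.

Lemma cont_duhamel_xx : cont3 duhamel_xx pos2.
Proof.
intros U T x B p HT Hx HB H. apply cont_minus.
- now apply (cont_edge (- 1) fx Cfx).
- now apply (cont_layer (- 1) fx Kr Cfx CKr).
Qed.

Lemma is_derive_duhamel_T (T x B : R) :
  0 < T -> 0 < B -> is_derive (fun T => duhamel T x B) T (duhamel_T T x B).
Proof.
intros hT hB.
apply (is_derive_R_eq _ _ _ _ (is_derive_layer_T 1 f K KT T x B Cf CK CKT
  (fun T B r => is_derive_kern_T mu P P1 P2 HP T B r) hT hB)).
unfold duhamel_T, edge, K. rewrite (kern_cone mu P P1 P2 HP). ring.
Qed.

Lemma is_derive_duhamel_TT (T x B : R) :
  0 < T -> 0 < B -> is_derive (fun T => duhamel_T T x B) T (duhamel_TT T x B).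
Proof.
intros hT hB.
exact (is_derive_R_plus _ _ _ _ _ (is_derive_layer_T 1 f KT KTT T x B Cf CKT CKTT
  (fun T B r => is_derive_kern_TT mu P P1 P2 HP T B r) hT hB)
  (is_derive_edge_T 1 T x B)).
Qed.

Lemma is_derive_duhamel_x (T x B : R) :
  0 < T -> 0 < B -> is_derive (fun x => duhamel T x B) x (duhamel_x T x B).
Proof. intros hT hB. now apply is_derive_layer_x. Qed.

Lemma is_derive_duhamel_T_x (T x B : R) :
  0 < T -> 0 < B -> is_derive (fun x => duhamel_T T x B) x (duhamel_Tx T x B).
Proof.
intros hT hB. apply is_derive_R_plus.
- now apply is_derive_layer_x.
- apply is_derive_edge_x.
Qed.

Lemma is_derive_duhamel_x_T (T x B : R) :
  0 < T -> 0 < B -> is_derive (fun T => duhamel_x T x B) T (duhamel_Tx T x B).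
Proof.
intros hT hB.
apply (is_derive_R_eq _ _ _ _ (is_derive_layer_T 1 fx K KT T x B Cfx CK CKT
  (fun T B r => is_derive_kern_T mu P P1 P2 HP T B r) hT hB)).
unfold duhamel_Tx, edge, K. rewrite (kern_cone mu P P1 P2 HP). ring.
Qed.

Lemma layer_slice_continuous (s : R) (h : R -> R -> R) (k : R -> R -> R -> R)
  (T x B : R) :
  (forall t y, cont2 h t y) -> cont_kernel k -> 0 < T -> 0 < B ->
  forall r, continuous (fun r => refl_sum s (h B) x r * k T B r) r.
Proof.
intros Hh Hk hT hB r.
apply (cont_layer_integrand s h k (fun _ => T) (fun _ => x) (fun _ => B)
    (fun r => r)); auto; try apply continuous_const; apply continuous_id.
Qed.

(** The source has only one derivative in [x], so the first derivative of the
    wave is integrated by parts before the second one is taken. *)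
Lemma layer_by_parts (s : R) (k kr : R -> R -> R -> R) (T x B : R) :
  cont_kernel k -> cont_kernel kr ->
  (forall r, is_derive (fun r => k T B r) r (kr T B r)) ->
  0 < T -> 0 < B ->
  layer s fx k T x B = refl_sum (- s) (f B) x (T - B) * k T B (T - B)
    - refl_sum (- s) (f B) x 0 * k T B 0 - layer (- s) f kr T x B.
Proof.
intros Hk Hkr Hd hT hB.
assert (C1 := layer_slice_continuous s fx k T x B Cfx Hk hT hB).
assert (C2 := layer_slice_continuous (- s) f kr T x B Cf Hkr hT hB).
assert (H : RInt (fun r => refl_sum s (fx B) x r * k T B r
    + refl_sum (- s) (f B) x r * kr T B r) 0 (T - B)
  = refl_sum (- s) (f B) x (T - B) * k T B (T - B) - refl_sum (- s) (f B) x 0 * k T B 0).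
{ apply (RInt_R_derive (fun r => refl_sum (- s) (f B) x r * k T B r)).
  - intros r _.
    assert (H := is_derive_R_mult _ _ _ _ _
      (is_derive_refl_sum (- s) (f B) (fx B) x r (Df B)) (Hd r)).
    rewrite Ropp_involutive in H. exact H.
  - intros r _. now apply cont_plus. }
rewrite RInt_R_plus in H by now apply ex_RInt_R.
unfold layer. lra.
Qed.

Lemma duhamel_x_by_parts (T x B : R) :
  0 < T -> 0 < B ->
  duhamel_x T x B = edge (- 1) f T x B - layer (- 1) f Kr T x B.
Proof.
intros hT hB. unfold duhamel_x.
rewrite (layer_by_parts 1 K Kr T x B CK CKr
  (fun r => is_derive_kern_r mu P P1 P2 HP T B r hT hB) hT hB).
unfold K at 1. rewrite (kern_cone mu P P1 P2 HP).
replace (- (1)) with (- 1) by ring.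
unfold edge, refl_sum. rewrite Rplus_0_r, Rminus_0_r. ring.
Qed.

Lemma is_derive_duhamel_xx (T x B : R) :
  0 < T -> 0 < B -> is_derive (fun x => duhamel_x T x B) x (duhamel_xx T x B).
Proof.
intros hT hB.
apply is_derive_ext with (fun x => edge (- 1) f T x B - layer (- 1) f Kr T x B).
{ intros y. symmetry. now apply duhamel_x_by_parts. }
exact (is_derive_minus _ _ _ _ _ (is_derive_edge_x (- 1) T x B)
  (is_derive_layer_x (- 1) f fx Kr T x B Cf Cfx CKr Df hT hB)).
Qed.

(** The two boundary terms with [f] on the cone cancel by [kern_cone_T], those
    with [fx] are equal. *)
Lemma duhamel_equation (T x B : R) :
  0 < T -> 0 < B ->
  duhamel_TT T x B - duhamel_xx T x B = mu / T ^ 2 * duhamel T x B.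
Proof.
intros hT hB. unfold duhamel_TT, duhamel_xx.
rewrite (layer_by_parts (- 1) Kr Krr T x B CKr CKrr
  (fun r => is_derive_kern_rr mu P P1 P2 HP T B r hT hB) hT hB).
replace (- - 1) with 1 by ring. unfold Kr at 2. rewrite kern_r_0.
replace (KT T B (T - B)) with (- Kr T B (T - B))
  by (assert (H := kern_cone_T P1 T B hT hB); unfold Kr, KT; lra).
transitivity (layer 1 f KTT T x B - layer 1 f Krr T x B); [ring|].
unfold duhamel, layer.
assert (C1 := layer_slice_continuous 1 f K T x B Cf CK hT hB).
assert (C2 := layer_slice_continuous 1 f KTT T x B Cf CKTT hT hB).
assert (C3 := layer_slice_continuous 1 f Krr T x B Cf CKrr hT hB).
rewrite <- RInt_R_minus, <- RInt_R_scal by now apply ex_RInt_R.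
apply RInt_R_ext. intros r Hr.
assert (Hr2 : r ^ 2 <= (T - B) ^ 2).
{ revert Hr. unfold Rmin, Rmax. destruct Rle_dec; intros; nra. }
assert (HE := kern_equation mu P P1 P2 HP T B r hT hB Hr2).
unfold KTT, Krr, K.
transitivity (refl_sum 1 (f B) x r * (kern_TT P1 P2 T B r - kern_rr P1 P2 T B r)); [ring|].
rewrite HE. ring.
Qed.

Lemma duhamel_apex (T x : R) : duhamel T x T = 0.
Proof. unfold duhamel, layer. rewrite Rminus_diag. apply (RInt_point (V := R_CompleteNormedModule)). Qed.

Lemma duhamel_x_apex (T x : R) : duhamel_x T x T = 0.
Proof. unfold duhamel_x, layer. rewrite Rminus_diag. apply (RInt_point (V := R_CompleteNormedModule)). Qed.

Lemma duhamel_T_apex (T x : R) : duhamel_T T x T = f T x.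
Proof.
unfold duhamel_T, layer, edge, refl_sum. rewrite Rminus_diag, RInt_point.
rewrite Rplus_0_r, Rminus_0_r. unfold zero; simpl. field.
Qed.

(** Duhamel's principle: a wave vanishes at the time of its emission, where its
    time derivative is [f]; this value is what the moving upper limit adds to
    the second derivative. *)
Lemma duhamel_solution :
  exists q qT qx qTT qTx qxx,
  C2_jet e q qT qx qTT qTx qxx /\
  (forall T x, e < T -> qTT T x - qxx T x = mu / T ^ 2 * q T x + f T x) /\
  forall x, q T0 x = 0 /\ qT T0 x = 0.
Proof.
set (S := superpose e T0).
exists (S duhamel), (S duhamel_T), (S duhamel_x), (fun T x => S duhamel_TT T x + f T x),
  (S duhamel_Tx), (S duhamel_xx).
split; [|split].
- intros T x hT. assert (hT0 : 0 < T) by lra.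
  split; [split; [|split; [|split; [|split; [|split]]]]|split; [|split; [|split; [|split; [|split]]]]].
  + apply cont_superpose; [exact he|apply cont_duhamel|exact hT0].
  + apply cont_superpose; [exact he|apply cont_duhamel_T|exact hT0].
  + apply cont_superpose; [exact he|apply cont_duhamel_x|exact hT0].
  + apply cont_plus; [|apply Cf].
    apply cont_superpose; [exact he|apply cont_duhamel_TT|exact hT0].
  + apply cont_superpose; [exact he|apply cont_duhamel_Tx|exact hT0].
  + apply cont_superpose; [exact he|apply cont_duhamel_xx|exact hT0].
  + apply (is_derive_R_eq _ _ _ _ (is_derive_superpose_T e T0 duhamel he cont_duhamel
      duhamel_T T x cont_duhamel_T (fun T B => is_derive_duhamel_T T x B) hT)).
    rewrite duhamel_apex. apply Rplus_0_r.
  + apply (is_derive_superpose_x e T0 duhamel he cont_duhamel duhamel_x T x cont_duhamel_x); auto.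
    intros y B hB. now apply is_derive_duhamel_x.
  + apply (is_derive_R_eq _ _ _ _ (is_derive_superpose_T e T0 duhamel_T he cont_duhamel_T
      duhamel_TT T x cont_duhamel_TT (fun T B => is_derive_duhamel_TT T x B) hT)).
    now rewrite duhamel_T_apex.
  + apply (is_derive_superpose_x e T0 duhamel_T he cont_duhamel_T duhamel_Tx T x cont_duhamel_Tx); auto.
    intros y B hB. now apply is_derive_duhamel_T_x.
  + apply (is_derive_R_eq _ _ _ _ (is_derive_superpose_T e T0 duhamel_x he cont_duhamel_x
      duhamel_Tx T x cont_duhamel_Tx (fun T B => is_derive_duhamel_x_T T x B) hT)).
    rewrite duhamel_x_apex. apply Rplus_0_r.
  + apply (is_derive_superpose_x e T0 duhamel_x he cont_duhamel_x duhamel_xx T x cont_duhamel_xx); auto.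
    intros y B hB. now apply is_derive_duhamel_xx.
- intros T x hT. assert (hT0 : 0 < T) by lra.
  assert (Ex1 := ex_RInt_superpose e duhamel_TT he cont_duhamel_TT T x T0 T hT0).
  assert (Ex2 := ex_RInt_superpose e duhamel_xx he cont_duhamel_xx T x T0 T hT0).
  assert (Ex3 := ex_RInt_superpose e duhamel he cont_duhamel T x T0 T hT0).
  assert (H : S duhamel_TT T x - S duhamel_xx T x = mu / T ^ 2 * S duhamel T x).
  { unfold S, superpose. rewrite <- RInt_R_minus, <- RInt_R_scal by assumption.
    apply RInt_R_ext. intros B _.
    exact (duhamel_equation T x (Rmax B e) hT0 (clamp_pos e he B)). }
  lra.
- intros x. split; apply (RInt_point (V := R_CompleteNormedModule)).
Qed.

End Duhamel.

(** The data are carried by a solution of the free wave equation, whose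
    defect [mu / T^2 p] joins the source. *)
Lemma flat_cauchy_problem (mu : R) (P P1 P2 : R -> R) (T0 : R)
  (f fx : R -> R -> R) (w0 w0' w0'' w1 w1' : R -> R) :
  legendre_profile mu P P1 P2 -> 0 < T0 ->
  (forall t y, cont2 f t y) -> (forall t y, cont2 fx t y) ->
  (forall t y, is_derive (f t) y (fx t y)) ->
  (forall y, is_derive w0 y (w0' y)) -> (forall y, is_derive w0' y (w0'' y)) ->
  (forall y, continuous w0'' y) ->
  (forall y, is_derive w1 y (w1' y)) -> (forall y, continuous w1' y) ->
  exists w wT wx wTT wTx wxx,
  C2_jet (T0 / 2) w wT wx wTT wTx wxx /\
  (forall T x, T0 <= T -> wTT T x - wxx T x = mu / T ^ 2 * w T x + f T x) /\
  forall x, w T0 x = w0 x /\ wT T0 x = w1 x.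
Proof.
intros HP hT0 Cf Cfx Df D0 D1 C0 E0 C1.
assert (Cw1 : forall y, continuous w1 y).
{ intros y. apply is_derive_R_continuous with (w1' y). apply E0. }
set (I := fun y => RInt w1 0 y).
assert (DI : forall y, is_derive I y (w1 y)).
{ intros y. apply (is_derive_RInt w1 I 0); [|apply Cw1].
  apply filter_forall. intros b.
  apply (RInt_correct (V := R_CompleteNormedModule)), ex_RInt_R, Cw1. }
(* d'Alembert's two travelling waves *)
set (al := fun s y => / 2 * w0 y + s * I y).
set (al' := fun s y => / 2 * w0' y + s * w1 y).
set (al'' := fun s y => / 2 * w0'' y + s * w1' y).
assert (Da : forall s y, is_derive (al s) y (al' s y)).
{ intros s y. apply is_derive_R_plus; apply is_derive_R_scal; auto. }
assert (Da' : forall s y, is_derive (al' s) y (al'' s y)).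
{ intros s y. apply is_derive_R_plus; apply is_derive_R_scal; auto. }
assert (Ca : forall s y, continuous (al s) y).
{ intros s y. apply is_derive_R_continuous with (al' s y). auto. }
assert (Ca' : forall s y, continuous (al' s) y).
{ intros s y. apply is_derive_R_continuous with (al'' s y). auto. }
assert (Ca'' : forall s y, continuous (al'' s) y).
{ intros s y. apply cont_plus; (apply cont_mult; [apply continuous_const|auto]). }
set (wave := fun (s : R) (a : R -> R -> R) T x =>
  a (/ 2) (x + (T - T0)) + s * a (- / 2) (x - (T - T0))).
assert (Cwave : forall s a, (forall s y, continuous (a s) y) ->
  forall T x, cont2 (wave s a) T x).
{ intros s a Ha T x. unfold cont2, wave.
  assert (Cd : continuous (fun q : R * R => fst q - T0) (T, x)).
  { apply cont_minus; [apply continuous_fst|apply continuous_const]. }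
  apply cont_plus; [|apply cont_mult; [apply continuous_const|]].
  - apply (cont_comp (a (/ 2)) (fun q : R * R => snd q + (fst q - T0))); [|apply Ha].
    apply cont_plus; [apply continuous_snd|exact Cd].
  - apply (cont_comp (a (- / 2)) (fun q : R * R => snd q - (fst q - T0))); [|apply Ha].
    apply cont_minus; [apply continuous_snd|exact Cd]. }
assert (DwT : forall s a a', (forall s y, is_derive (a s) y (a' s y)) ->
  forall T x, is_derive (fun T => wave s a T x) T (wave (- s) a' T x)).
{ intros s a a' Ha T x. unfold wave.
  assert (H1 : is_derive (fun T => a (/ 2) (x + (T - T0))) T
     (a' (/ 2) (x + (T - T0)) * 1)).
  { apply (is_derive_R_comp (a (/ 2)) (fun T => x + (T - T0))); [apply Ha|].
    auto_derive; auto; ring. }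
  assert (H2 : is_derive (fun T => a (- / 2) (x - (T - T0))) T
     (a' (- / 2) (x - (T - T0)) * -1)).
  { apply (is_derive_R_comp (a (- / 2)) (fun T => x - (T - T0))); [apply Ha|].
    auto_derive; auto; ring. }
  apply (is_derive_R_eq _ _ _ _
    (is_derive_R_plus _ _ _ _ _ H1 (is_derive_R_scal _ _ s _ H2))).
  ring. }
assert (Dwx : forall s a a', (forall s y, is_derive (a s) y (a' s y)) ->
  forall T x, is_derive (fun x => wave s a T x) x (wave s a' T x)).
{ intros s a a' Ha T x. unfold wave.
  assert (H1 : is_derive (fun x => a (/ 2) (x + (T - T0))) x
     (a' (/ 2) (x + (T - T0)) * 1)).
  { apply (is_derive_R_comp (a (/ 2)) (fun x => x + (T - T0))); [apply Ha|].
    auto_derive; auto; ring. }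
  assert (H2 : is_derive (fun x => a (- / 2) (x - (T - T0))) x
     (a' (- / 2) (x - (T - T0)) * 1)).
  { apply (is_derive_R_comp (a (- / 2)) (fun x => x - (T - T0))); [apply Ha|].
    auto_derive; auto; ring. }
  apply (is_derive_R_eq _ _ _ _
    (is_derive_R_plus _ _ _ _ _ H1 (is_derive_R_scal _ _ s _ H2))).
  ring. }
(* the coefficient is frozen before the initial time, so that the source is
   continuous on the whole plane *)
set (m := fun T => mu * / Rmax T T0 ^ 2).
assert (Cm : forall T x : R, continuous (fun q : R * R => m (fst q)) (T, x)).
{ intros T x. apply cont_mult; [apply continuous_const|].
  apply cont_inv; [apply cont_pow, cont_Rmax, continuous_fst|].
  apply pow_nonzero. simpl. assert (H := Rmax_r T T0). lra. }
set (F := fun T x => f T x + m T * wave 1 al T x).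
set (Fx := fun T x => fx T x + m T * wave 1 al' T x).
destruct (duhamel_solution mu P P1 P2 HP (T0 / 2) T0 F Fx)
  as (q & qT & qx & qTT & qTx & qxx & Hjet & Heq & Hdata).
- lra.
- intros t y. apply cont_plus; [apply Cf|].
  apply cont_mult; [apply Cm|now apply Cwave].
- intros t y. apply cont_plus; [apply Cfx|].
  apply cont_mult; [apply Cm|now apply Cwave].
- intros t y. apply is_derive_R_plus; [apply Df|]. now apply is_derive_R_scal, Dwx.
- exists (fun T x => q T x + wave 1 al T x), (fun T x => qT T x + wave (- 1) al' T x),
    (fun T x => qx T x + wave 1 al' T x), (fun T x => qTT T x + wave 1 al'' T x),
    (fun T x => qTx T x + wave (- 1) al'' T x), (fun T x => qxx T x + wave 1 al'' T x).
  split; [|split].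
  + intros T x hT.
    destruct (Hjet T x hT) as ((c1 & c2 & c3 & c4 & c5 & c6) & d1 & d2 & d3 & d4 & d5 & d6).
    split.
    { split; [|split; [|split; [|split; [|split]]]];
        (apply cont_plus; [assumption|now apply Cwave]). }
    split; [|split; [|split; [|split; [|split]]]];
      (apply is_derive_R_plus; [assumption|]).
    * now apply (DwT 1 al al').
    * now apply (Dwx 1 al al').
    * apply (is_derive_R_eq _ _ _ _ (DwT (- 1) al' al'' Da' T x)).
      now replace (- - 1) with 1 by ring.
    * now apply (Dwx (- 1) al' al'').
    * now apply (DwT 1 al' al'').
    * now apply (Dwx 1 al' al'').
  + intros T x hT. assert (H := Heq T x ltac:(lra)). revert H. unfold F, m.
    rewrite Rmax_left by lra. intros H. unfold Rdiv in *. lra.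
  + intros x. destruct (Hdata x) as [-> ->].
    unfold wave, al, al'. rewrite Rminus_diag, Rplus_0_r, Rminus_0_r. split; field.
Qed.

(** * One-sided derivatives *)

Lemma within_half_proper (t : R) :
  1 <= t -> ProperFilter (within (fun s => 1 <= s) (locally t)).
Proof.
intros ht. constructor.
- intros Q [d Hd]. exists (t + d / 2). apply Hd.
  + change (Rabs (t + d / 2 - t) < d). assert (Hd0 := cond_pos d).
    rewrite Rabs_pos_eq; lra.
  + assert (Hd0 := cond_pos d). lra.
- apply within_filter, locally_filter.
Qed.

Lemma within_half_lim (t : R) : is_filter_lim (within (fun s => 1 <= s) (locally t)) t.
Proof. intros Q HQ. now apply filter_le_within. Qed.

Lemma is_derive_half_of_derive (f : R -> R) (t l : R) :
  1 <= t -> is_derive f t l -> is_derive_half f t l.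
Proof.
intros ht H. apply (filterdiff_locally (FF := within_half_proper t ht) f t).
- apply within_half_lim.
- exact H.
Qed.

Lemma is_derive_of_half (f : R -> R) (t l : R) :
  1 < t -> is_derive_half f t l -> is_derive f t l.
Proof.
intros ht [Hl Hd]. split; [exact Hl|]. intros y Hy.
rewrite <- (is_filter_lim_locally_unique (K := R_AbsRing) (V := R_NormedModule) _ _ Hy).
intros eps.
assert (L : locally t (fun s => 1 < s)).
{ apply (locally_open (fun s => 1 < s)); auto. apply open_gt. }
generalize (filter_and _ _ L (Hd t (within_half_lim t) eps)).
apply filter_imp. intros s [hs H]. apply H. lra.
Qed.

Lemma is_derive_half_unique (f : R -> R) (t l l' : R) :
  1 <= t -> is_derive_half f t l -> is_derive_half f t l' -> l = l'.
Proof.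
intros ht [_ H] [_ H'].
apply cond_eq. intros eps he.
assert (he4 : 0 < eps / 4) by lra.
destruct (filter_and _ _ (H t (within_half_lim t) (mkposreal _ he4))
  (H' t (within_half_lim t) (mkposreal _ he4))) as [d Hd].
assert (Hd0 := cond_pos d).
destruct (Hd (t + d / 2)) as [h1 h2].
- change (Rabs (t + d / 2 - t) < d). rewrite Rabs_pos_eq; lra.
- lra.
- revert h1 h2. unfold norm, minus, plus, opp, scal; simpl.
  unfold abs, mult; simpl.
  replace (t + d / 2 + - t) with (d / 2) by ring.
  rewrite (Rabs_pos_eq (d / 2)) by lra.
  set (D := f (t + d / 2) + - f t). intros h1 h2.
  apply Rmult_lt_reg_r with (d / 2); [lra|].
  rewrite <- (Rabs_pos_eq (d / 2)) at 1 by lra. rewrite <- Rabs_mult.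
  apply Rle_lt_trans with (eps / 4 * (d / 2) + eps / 4 * (d / 2)); [|nra].
  replace ((l - l') * (d / 2)) with ((D + - (d / 2 * l')) - (D + - (d / 2 * l))) by ring.
  revert h1 h2. generalize (D + - (d / 2 * l')) (D + - (d / 2 * l)).
  unfold Rabs. intros. repeat destruct Rcase_abs; lra.
Qed.

Lemma continuous_half_of_cont2 (h : R -> R -> R) :
  (forall t x, 1 <= t -> cont2 h t x) -> continuous_half h.
Proof.
intros H [t x] ht. apply (filterlim_filter_le_1 _ (filter_le_within _)).
exact (H t x ht).
Qed.

(** This is how functions on the closed half-plane enter the lemmas about the
    whole plane. *)
Lemma cont2_half_comp (h : R -> R -> R) (tau : R -> R) :
  continuous_half h -> (forall T, 1 <= tau T) -> (forall T, continuous tau T) ->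
  forall T x, cont2 (fun T x => h (tau T) x) T x.
Proof.
intros Hh H1 Ht T x. unfold cont2.
assert (Hp : filterlim (fun q : R * R => (tau (fst q), snd q)) (locally (T, x))
  (within (fun p : R * R => 1 <= fst p) (locally (tau T, x)))).
{ intros S HS.
  assert (Hc : continuous (fun q : R * R => (tau (fst q), snd q)) (T, x)).
  { apply (continuous_comp_2 (fun q : R * R => tau (fst q)) snd (fun a b => (a, b))).
    - apply (cont_fst_comp tau), Ht.
    - apply continuous_snd.
    - intros Q [e He]. exists e. intros [a b] Hab. now apply He. }
  unfold filtermap. apply (filter_imp (fun q : R * R => 1 <= tau (fst q) -> S (tau (fst q), snd q))).
  - intros q Hq. apply Hq, H1.
  - exact (Hc _ HS). }
exact (filterlim_comp _ _ _ _ _ _ _ _ Hp (Hh (tau T, x) (H1 T))).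
Qed.

Lemma Derive_n_2 (f f1 : R -> R) (x f2 : R) :
  locally x (fun y => is_derive f y (f1 y)) -> is_derive f1 x f2 ->
  Derive_n f 2 x = f2.
Proof.
intros H1 H2. change (Derive (fun y => Derive f y) x = f2).
rewrite (Derive_ext_loc _ f1).
- now apply is_derive_unique.
- revert H1. apply filter_imp. intros y. apply is_derive_unique.
Qed.

(** * The change of time variable *)

Definition psi (k T : R) : R := Rpower ((1 - k) * T) (1 / (1 - k)).

Lemma is_derive_Rpower (t e : R) :
  0 < t -> is_derive (fun t => Rpower t e) t (e * Rpower t e / t).
Proof. intros ht. unfold Rpower. auto_derive; [lra|field; lra]. Qed.

Lemma Rpower_1_l (e : R) : Rpower 1 e = 1.
Proof. unfold Rpower. rewrite ln_1, Rmult_0_r. apply exp_0. Qed.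

Lemma Rpower_pos (t e : R) : 0 < Rpower t e.
Proof. apply exp_pos. Qed.

Section Time.

Variable k : R.
Hypothesis hk : 0 < k < 1.

Lemma phi_pos (t : R) : 0 < phi k t.
Proof. apply Rdiv_lt_0_compat; [apply Rpower_pos|lra]. Qed.

Lemma is_derive_phi (t : R) : 0 < t -> is_derive (phi k) t (Rpower t (- k)).
Proof.
intros ht.
apply (is_derive_R_eq _ _ (/ (1 - k) * ((1 - k) * Rpower t (1 - k) / t))).
- apply is_derive_ext with (fun t => / (1 - k) * Rpower t (1 - k)).
  + intros s. unfold phi, Rdiv. apply Rmult_comm.
  + now apply is_derive_R_scal, is_derive_Rpower.
- replace (1 - k) with (1 + - k) at 3 by ring. rewrite Rpower_plus, Rpower_1 by lra.
  field. lra.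
Qed.

Lemma phi_eq (t : R) : 0 < t -> phi k t = t * Rpower t (- k) / (1 - k).
Proof.
intros ht. unfold phi, Rminus. rewrite Rpower_plus, Rpower_1 by lra. reflexivity.
Qed.

Lemma phi_le (s t : R) : 0 < s -> s <= t -> phi k s <= phi k t.
Proof.
intros hs hst. apply Rmult_le_compat_r.
- left. apply Rinv_0_lt_compat. lra.
- apply Rle_Rpower_l; lra.
Qed.

Lemma phi_lt (s t : R) : 0 < s -> s < t -> phi k s < phi k t.
Proof.
intros hs hst. apply Rmult_lt_compat_r.
- apply Rinv_0_lt_compat. lra.
- apply Rlt_Rpower_l; lra.
Qed.

Lemma psi_phi (t : R) : 0 < t -> psi k (phi k t) = t.
Proof.
intros ht. unfold psi, phi.
replace ((1 - k) * (Rpower t (1 - k) / (1 - k))) with (Rpower t (1 - k)) by (field; lra).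
rewrite Rpower_mult. replace ((1 - k) * (1 / (1 - k))) with 1 by (field; lra).
now apply Rpower_1.
Qed.

Lemma phi_psi (T : R) : 0 < T -> phi k (psi k T) = T.
Proof.
intros hT. unfold psi, phi. rewrite Rpower_mult.
replace (1 / (1 - k) * (1 - k)) with 1 by (field; lra).
rewrite Rpower_1 by (apply Rmult_lt_0_compat; lra). field. lra.
Qed.

Lemma psi_pos (T : R) : 0 < psi k T.
Proof. apply Rpower_pos. Qed.

Lemma psi_ge_1 (T : R) : phi k 1 <= T -> 1 <= psi k T.
Proof.
intros hT. destruct (Rle_lt_dec 1 (psi k T)) as [h|h]; [exact h|].
assert (H0 := phi_pos 1).
assert (H := phi_lt _ _ (psi_pos T) h). rewrite phi_psi in H by lra. lra.
Qed.

Lemma psi_gt_1 (T : R) : phi k 1 < T -> 1 < psi k T.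
Proof.
intros hT. destruct (Rlt_le_dec 1 (psi k T)) as [h|h]; [exact h|].
assert (H0 := phi_pos 1).
assert (H := phi_le _ _ (psi_pos T) h). rewrite phi_psi in H by lra. lra.
Qed.

Lemma is_derive_psi (T : R) : 0 < T -> is_derive (psi k) T (Rpower (psi k T) k).
Proof.
intros hT.
assert (hkT : 0 < (1 - k) * T) by (apply Rmult_lt_0_compat; lra).
apply (is_derive_R_eq _ _
  ((1 / (1 - k)) * Rpower ((1 - k) * T) (1 / (1 - k)) / ((1 - k) * T) * (1 - k))).
- apply (is_derive_R_comp (fun y => Rpower y (1 / (1 - k))) (fun T => (1 - k) * T)).
  + now apply is_derive_Rpower.
  + auto_derive; auto; ring.
- unfold psi. rewrite Rpower_mult.
  replace (1 / (1 - k) * k) with (1 / (1 - k) - 1) by (field; lra).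
  rewrite Rpower_minus1 by exact hkT. field. lra.
Qed.

(** The original time as a function of [T], frozen before the initial time, so
    that functions on the closed half-plane extend to the whole plane. *)
Definition clock (T : R) : R := psi k (Rmax T (phi k 1)).

Lemma clock_eq (T : R) : phi k 1 <= T -> clock T = psi k T.
Proof. intros hT. unfold clock. now rewrite Rmax_left. Qed.

Lemma clock_ge_1 (T : R) : 1 <= clock T.
Proof. apply psi_ge_1, Rmax_r. Qed.

Lemma clock_phi (t : R) : 1 <= t -> clock (phi k t) = t.
Proof.
intros ht. rewrite clock_eq.
- apply psi_phi. lra.
- apply phi_le; lra.
Qed.

Lemma cont_clock (T : R) : continuous clock T.
Proof.
apply (cont_comp (psi k) (fun T => Rmax T (phi k 1))).
- apply cont_Rmax, continuous_id.
- eapply is_derive_R_continuous. apply is_derive_psi.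
  assert (H := Rmax_r T (phi k 1)). assert (H0 := phi_pos 1). lra.
Qed.

Lemma cont_Rpower (t e : R) : 0 < t -> continuous (fun t => Rpower t e) t.
Proof. intros ht. eapply is_derive_R_continuous. now apply is_derive_Rpower. Qed.

Lemma cont_clock_power (e : R) (T x : R) :
  continuous (fun q : R * R => Rpower (clock (fst q)) e) (T, x).
Proof.
apply (cont_fst_comp (fun T => Rpower (clock T) e)).
apply (cont_comp (fun t => Rpower t e) clock); [apply cont_clock|].
apply cont_Rpower. assert (H := clock_ge_1 T). simpl. lra.
Qed.

Definition flat_source (g : R -> R -> R) (T x : R) : R :=
  Rpower (clock T) (1 + 3 * k / 2) * g (clock T) x.

Lemma cont_flat_source (g : R -> R -> R) (T x : R) :
  continuous_half g -> cont2 (flat_source g) T x.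
Proof.
intros Hg. apply cont_mult; [apply cont_clock_power|].
apply (cont2_half_comp g clock Hg clock_ge_1 cont_clock).
Qed.

(** * Identification of the kernel *)

Lemma gamma_le_1 : gamma k <= 1.
Proof.
unfold gamma. assert (H : 0 <= k / (2 * (1 - k))).
{ apply Rmult_le_pos; [lra|]. left. apply Rinv_0_lt_compat. lra. }
lra.
Qed.

(** On the characteristics [E] is [t^(k/2-1) b^(1+k/2) / 2]. *)
Lemma c_normalization (t b : R) :
  0 < t -> 0 < b ->
  c k * / t * b * Rpower (4 * phi k t * phi k b) (- gamma k)
  = Rpower t (k / 2 - 1) * Rpower b (1 + k / 2) * / 2.
Proof.
intros ht hb.
assert (h1k : 0 < 1 - k) by lra.
assert (H2 : forall u, 0 < u -> Rpower u 2 = u * u).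
{ intros u hu. replace 2 with (1 + 1) by ring. rewrite Rpower_plus, Rpower_1; auto. }
replace (4 * phi k t * phi k b) with
  (Rpower 2 2 * Rpower t (1 - k) * Rpower b (1 - k) * Rpower (1 - k) (- (2))).
2: { unfold phi. rewrite Rpower_Ropp.
     rewrite !H2 by lra.
     field. lra. }
assert (Hln : forall u e, ln (Rpower u e) = e * ln u).
{ intros u e. unfold Rpower. apply ln_exp. }
unfold c. unfold Rpower at 3.
rewrite !ln_mult, !Hln by (repeat apply Rmult_lt_0_compat; apply Rpower_pos).
replace (/ t) with (exp (- ln t)) by (rewrite exp_Ropp, exp_ln; auto).
rewrite <- (exp_ln b hb) at 1.
replace (/ 2) with (exp (- ln 2)) by (rewrite exp_Ropp, exp_ln; lra).
unfold Rpower. rewrite <- !exp_plus. f_equal. unfold gamma. field. lra.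
Qed.

(** From [1 + zeta = ((T + B)^2 - r^2) / (4 T B)] the power of the first factor
    of [E] splits into the power in Pfaff's formula and a power of [4 T B]. *)
Lemma E_eq_kern (P : R -> R) (t x b y : R) :
  (forall z, 0 <= z -> P z = pfaff (gamma k) z) ->
  0 < t -> 0 < b -> (y - x) ^ 2 <= (phi k t - phi k b) ^ 2 ->
  E k t x b y
  = Rpower t (k / 2 - 1) * Rpower b (1 + k / 2) * kern P (phi k t) (phi k b) (y - x).
Proof.
intros HP ht hb hy. unfold E, kern.
assert (hT := phi_pos t). assert (hB := phi_pos b).
assert (hz := zeta_nonneg _ _ _ hT hB hy).
rewrite HP by exact hz. unfold pfaff.
set (T := phi k t) in *. set (B := phi k b) in *. set (r := y - x) in *.
assert (hS : 0 < (T + B) ^ 2 - r ^ 2) by nra.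
assert (hTB : 0 < 4 * T * B) by nra.
assert (H1z : 1 + zeta T B r = ((T + B) ^ 2 - r ^ 2) * / (4 * T * B)).
{ unfold zeta. field. lra. }
assert (Harg : zeta T B r / (1 + zeta T B r)
  = ((T - B) ^ 2 - r ^ 2) / ((T + B) ^ 2 - r ^ 2)).
{ rewrite H1z. unfold zeta. field. repeat split; nra. }
rewrite Harg, H1z.
rewrite <- Rpower_mult_distr by (auto; now apply Rinv_0_lt_compat).
change (hyp2F1 (gamma k) (gamma k) 1 (((T - B) ^ 2 - r ^ 2) / ((T + B) ^ 2 - r ^ 2)))
  with (hyp_F (gamma k) (((T - B) ^ 2 - r ^ 2) / ((T + B) ^ 2 - r ^ 2))).
assert (Hc := c_normalization t b ht hb). fold T B in Hc.
rewrite <- (Rmult_assoc (Rpower t (k / 2 - 1) * Rpower b (1 + k / 2))), <- Hc.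
assert (HI : Rpower (4 * T * B) (- gamma k) * Rpower (/ (4 * T * B)) (- gamma k) = 1).
{ rewrite Rpower_mult_distr by (auto; now apply Rinv_0_lt_compat).
  rewrite Rinv_r by lra. apply Rpower_1_l. }
transitivity (c k * / t * b * Rpower ((T + B) ^ 2 - r ^ 2) (- gamma k)
  * hyp_F (gamma k) (((T - B) ^ 2 - r ^ 2) / ((T + B) ^ 2 - r ^ 2))
  * (Rpower (4 * T * B) (- gamma k) * Rpower (/ (4 * T * B)) (- gamma k))).
- rewrite HI. ring.
- ring.
Qed.

End Time.

(** * Existence of a solution *)

Lemma class_C_2 (f : R -> R) :
  class_C 2 f ->
  (forall y, is_derive f y (Derive f y)) /\
  (forall y, is_derive (Derive f) y (Derive_n f 2 y)) /\
  (forall y, continuous (Derive_n f 2) y).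
Proof.
intros H. split; [|split]; intros y.
- apply Derive_correct. exact (proj1 (H 1%nat ltac:(lia) y)).
- apply (Derive_correct (Derive_n f 1)). exact (proj1 (H 2%nat ltac:(lia) y)).
- exact (proj2 (H 2%nat ltac:(lia) y)).
Qed.

Lemma class_C_1 (f : R -> R) :
  class_C 1 f ->
  (forall y, is_derive f y (Derive f y)) /\ (forall y, continuous (Derive f) y).
Proof.
intros H. split; intros y.
- apply Derive_correct. exact (proj1 (H 1%nat ltac:(lia) y)).
- exact (proj2 (H 1%nat ltac:(lia) y)).
Qed.

Definition wave_mu (k : R) : R := gamma k * (gamma k - 1).

Section Lift.

Variable k : R.
Hypothesis hk : 0 < k < 1.

Definition lift (e : R) (w : R -> R -> R) (t x : R) : R :=
  Rpower t e * w (phi k t) x.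

Lemma cont_lift (e : R) (w : R -> R -> R) (t x : R) :
  0 < t -> cont2 w (phi k t) x -> cont2 (lift e w) t x.
Proof.
intros ht Hw. apply cont_mult.
- apply (cont_fst_comp (fun t => Rpower t e)). now apply cont_Rpower.
- apply (cont_comp_2 w (fun q : R * R => phi k (fst q)) snd).
  + apply (cont_fst_comp (phi k)). eapply is_derive_R_continuous.
    now apply is_derive_phi.
  + apply continuous_snd.
  + exact Hw.
Qed.

Lemma is_derive_lift_t (e : R) (w wT : R -> R -> R) (t x : R) :
  0 < t -> is_derive (fun T => w T x) (phi k t) (wT (phi k t) x) ->
  is_derive (fun t => lift e w t x) t
    (e * lift (e - 1) w t x + lift (e - k) wT t x).
Proof.
intros ht Hw. unfold lift.
assert (H1 := is_derive_Rpower t e ht).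
assert (H2 := is_derive_R_comp (fun T => w T x) (phi k) t _ _ Hw
  (is_derive_phi k hk t ht)).
apply (is_derive_R_eq _ _ _ _ (is_derive_R_mult _ _ _ _ _ H1 H2)).
rewrite Rpower_minus1 by exact ht. unfold Rminus at 1. rewrite Rpower_plus.
field. lra.
Qed.

Lemma is_derive_lift_x (e : R) (w wx : R -> R -> R) (t x : R) :
  is_derive (w (phi k t)) x (wx (phi k t) x) ->
  is_derive (lift e w t) x (lift e wx t x).
Proof. intros Hw. now apply is_derive_R_scal. Qed.

(** The factor [t^(k/2-1)] is the one for which both the damping term and
    the first-order term produced by the new time variable disappear. *)
Lemma lifted_equation (g w wT wTT wxx : R -> R -> R) (t x : R) :
  0 < t ->
  wTT (phi k t) x - wxx (phi k t) x
    = wave_mu k / phi k t ^ 2 * w (phi k t) x + Rpower t (1 + 3 * k / 2) * g t x ->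
  let e := k / 2 - 1 in
  e * ((e - 1) * lift (e - 1 - 1) w t x + lift (e - 1 - k) wT t x)
  + ((e - k) * lift (e - k - 1) wT t x + lift (e - k - k) wTT t x)
  - Rpower t (- (2 * k)) * lift e wxx t x
  + 2 * / t * (e * lift (e - 1) w t x + lift (e - k) wT t x) = g t x.
Proof.
intros ht Heq e. unfold lift.
set (a := Rpower t e). set (q := Rpower t (- k)).
assert (ha : 0 < a) by apply Rpower_pos.
assert (hq : 0 < q) by apply Rpower_pos.
rewrite !(Rpower_minus1 t (e - 1)), !(Rpower_minus1 t (e - k)),
  !(Rpower_minus1 t e) by exact ht. fold a.
assert (Hk : forall s, Rpower t (s - k) = Rpower t s * q).
{ intros s. unfold Rminus. apply Rpower_plus. }
rewrite !Hk, (Rpower_minus1 t e) by exact ht. fold a.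
replace (Rpower t (- (2 * k))) with (q * q)
  by (unfold q; rewrite <- Rpower_plus; f_equal; ring).
assert (Hsrc : a * q * q * Rpower t (1 + 3 * k / 2) = 1).
{ unfold a, q. rewrite <- !Rpower_plus.
  replace (e + - k + - k + (1 + 3 * k / 2)) with 0 by (unfold e; field).
  now apply Rpower_O. }
assert (HTT : wTT (phi k t) x = wxx (phi k t) x
  + wave_mu k / phi k t ^ 2 * w (phi k t) x + Rpower t (1 + 3 * k / 2) * g t x) by lra.
rewrite HTT.
set (W := w (phi k t) x). set (WT := wT (phi k t) x). set (WX := wxx (phi k t) x).
rewrite (phi_eq k t ht). fold q.
transitivity (a * q * q * Rpower t (1 + 3 * k / 2) * g t x); [|rewrite Hsrc; ring].
unfold wave_mu, gamma, e. field. repeat split; lra.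
Qed.

End Lift.

Lemma solution_exists (k : R) (u0 u1 : R -> R) (g : R -> R -> R) :
  0 < k < 1 -> class_C 2 u0 -> class_C 1 u1 -> class_C01 g ->
  exists u, is_solution k u0 u1 g u.
Proof.
intros hk hu0 hu1 [Cg (gx & Dg & Cgx)].
destruct (class_C_2 u0 hu0) as (D0 & D00 & C0).
destruct (class_C_1 u1 hu1) as (D1 & C1).
destruct (legendre_profile_exists (gamma k) (gamma_le_1 k hk)) as (P & P1 & P2 & HP & _).
fold (wave_mu k) in HP.
assert (hT0 := phi_pos k hk 1).
destruct (flat_cauchy_problem (wave_mu k) P P1 P2 (phi k 1)
  (flat_source k g) (flat_source k gx) u0 (Derive u0) (Derive_n u0 2)
  (fun y => (1 - k / 2) * u0 y + u1 y)
  (fun y => (1 - k / 2) * Derive u0 y + Derive u1 y))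
  as (w & wT & wx & wTT & wTx & wxx & Hjet & Heq & Hdata); auto.
- intros t y. now apply cont_flat_source.
- intros t y. now apply cont_flat_source.
- intros t y. apply is_derive_R_scal, Dg. now apply clock_ge_1.
- intros y. apply is_derive_R_plus; [apply is_derive_R_scal|]; auto.
- intros y. apply cont_plus; [apply cont_mult; [apply continuous_const|]|]; auto.
  apply is_derive_R_continuous with (Derive_n u0 2 y). auto.
- assert (Hpos : forall t, 1 <= t -> 0 < t /\ phi k 1 / 2 < phi k t).
  { intros t ht. split; [lra|]. assert (H := phi_le k hk 1 t ltac:(lra) ht). lra. }
  set (e := k / 2 - 1).
  set (ut := fun (a : R) (v vT : R -> R -> R) t x =>
    a * lift k (a - 1) v t x + lift k (a - k) vT t x).
  assert (Cut : forall a v vT t x, 0 < t -> cont2 v (phi k t) x ->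
    cont2 vT (phi k t) x -> cont2 (ut a v vT) t x).
  { intros a v vT t x ht Hv HvT. apply cont_plus.
    - apply cont_mult; [apply continuous_const|]. now apply (cont_lift k hk).
    - now apply (cont_lift k hk). }
  assert (Dlt : forall a v vT t x, 0 < t ->
    is_derive (fun T => v T x) (phi k t) (vT (phi k t) x) ->
    is_derive (fun t => lift k a v t x) t (ut a v vT t x)).
  { intros a v vT t x ht Hv. now apply (is_derive_lift_t k hk). }
  assert (Dutt : forall a v vT vTT t x, 0 < t ->
    is_derive (fun T => v T x) (phi k t) (vT (phi k t) x) ->
    is_derive (fun T => vT T x) (phi k t) (vTT (phi k t) x) ->
    is_derive (fun t => ut a v vT t x) t
      (a * ut (a - 1) v vT t x + ut (a - k) vT vTT t x)).
  { intros a v vT vTT t x ht Hv HvT. apply is_derive_R_plus.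
    - apply is_derive_R_scal. now apply Dlt.
    - now apply Dlt. }
  assert (Dutx : forall a v vT vx vTx t x,
    is_derive (v (phi k t)) x (vx (phi k t) x) ->
    is_derive (vT (phi k t)) x (vTx (phi k t) x) ->
    is_derive (ut a v vT t) x (ut a vx vTx t x)).
  { intros a v vT vx vTx t x Hv HvT. apply is_derive_R_plus.
    - apply is_derive_R_scal. now apply is_derive_lift_x.
    - now apply is_derive_lift_x. }
  set (utt := fun t x => e * ut (e - 1) w wT t x + ut (e - k) wT wTT t x).
  exists (lift k e w). split; [|split; [|split]].
  + split.
    { apply continuous_half_of_cont2. intros t x ht.
      destruct (Hpos t ht) as [h1 h2]. apply (cont_lift k hk); [exact h1|].
      apply (Hjet _ _ h2). }
    exists (ut e w wT), (lift k e wx). split; [|split].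
    * intros t x ht. destruct (Hpos t ht) as [h1 h2].
      destruct (Hjet (phi k t) x h2) as (_ & d1 & d2 & _).
      split; [apply is_derive_half_of_derive; [exact ht|now apply Dlt]|].
      now apply is_derive_lift_x.
    * split.
      { apply continuous_half_of_cont2. intros t x ht.
        destruct (Hpos t ht) as [h1 h2].
        destruct (Hjet (phi k t) x h2) as ((c1 & c2 & _) & _). now apply Cut. }
      exists utt, (ut e wx wTx). split; [|split; (split; [|exact I])].
      -- intros t x ht. destruct (Hpos t ht) as [h1 h2].
         destruct (Hjet (phi k t) x h2) as (_ & d1 & d2 & d3 & d4 & d5 & d6).
         split; [apply is_derive_half_of_derive; [exact ht|now apply Dutt]|].
         now apply Dutx.
      -- apply continuous_half_of_cont2. intros t x ht.
         destruct (Hpos t ht) as [h1 h2].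
         destruct (Hjet (phi k t) x h2) as ((c1 & c2 & c3 & c4 & c5 & c6) & _).
         apply cont_plus; [apply cont_mult; [apply continuous_const|]|];
           now apply Cut.
      -- apply continuous_half_of_cont2. intros t x ht.
         destruct (Hpos t ht) as [h1 h2].
         destruct (Hjet (phi k t) x h2) as ((c1 & c2 & c3 & c4 & c5 & c6) & _).
         now apply Cut.
    * split.
      { apply continuous_half_of_cont2. intros t x ht.
        destruct (Hpos t ht) as [h1 h2]. apply (cont_lift k hk); [exact h1|].
        apply (Hjet _ _ h2). }
      exists (ut e wx wTx), (lift k e wxx). split; [|split; (split; [|exact I])].
      -- intros t x ht. destruct (Hpos t ht) as [h1 h2].
         destruct (Hjet (phi k t) x h2) as (_ & d1 & d2 & d3 & d4 & d5 & d6).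
         split; [apply is_derive_half_of_derive; [exact ht|now apply Dlt]|].
         now apply is_derive_lift_x.
      -- apply continuous_half_of_cont2. intros t x ht.
         destruct (Hpos t ht) as [h1 h2].
         destruct (Hjet (phi k t) x h2) as ((c1 & c2 & c3 & c4 & c5 & c6) & _).
         now apply Cut.
      -- apply continuous_half_of_cont2. intros t x ht.
         destruct (Hpos t ht) as [h1 h2]. apply (cont_lift k hk); [exact h1|].
         apply (Hjet _ _ h2).
  + intros t x ht.
    assert (L : locally t (fun s => 1 < s)).
    { apply (locally_open (fun s => 1 < s)); auto. apply open_gt. }
    destruct (Hpos t (Rlt_le _ _ ht)) as [h1 h2].
    destruct (Hjet (phi k t) x h2) as (_ & d1 & d2 & d3 & d4 & d5 & d6).
    rewrite (Derive_n_2 _ (fun s => ut e w wT s x) t (utt t x)).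
    2: { revert L. apply filter_imp. intros s hs.
         destruct (Hpos s (Rlt_le _ _ hs)) as [h1' h2']. apply Dlt; [exact h1'|].
         apply (Hjet _ _ h2'). }
    2: now apply Dutt.
    rewrite (Derive_n_2 _ (lift k e wx t) x (lift k e wxx t x)).
    2: { apply filter_forall. intros y. apply is_derive_lift_x.
         apply (Hjet _ _ h2). }
    2: now apply is_derive_lift_x.
    replace (Derive (fun s => lift k e w s x) t) with (ut e w wT t x)
      by (symmetry; now apply is_derive_unique, Dlt).
    apply (lifted_equation k hk g w wT wTT wxx t x h1).
    rewrite (Heq (phi k t) x (phi_le k hk 1 t ltac:(lra) ltac:(lra))).
    unfold flat_source. now rewrite (clock_phi k hk t) by lra.
  + intros x. unfold lift. rewrite Rpower_1_l. destruct (Hdata x) as [-> _]. ring.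
  + intros x. destruct (Hpos 1 ltac:(lra)) as [h1 h2].
    apply is_derive_half_of_derive; [lra|].
    apply (is_derive_R_eq _ _ _ _ (Dlt e w wT 1 x h1 ltac:(apply (Hjet _ _ h2)))).
    unfold ut, lift. rewrite !Rpower_1_l. destruct (Hdata x) as [-> ->].
    unfold e. field.
Qed.

(** * The representation formula *)

Lemma RInt_refl_sum (h kap : R -> R) (x d : R) :
  (forall y, continuous h y) -> (forall r, continuous kap r) ->
  (forall r, kap (- r) = kap r) ->
  RInt (fun y => h y * kap (y - x)) (x - d) (x + d)
  = RInt (fun r => refl_sum 1 h x r * kap r) 0 d.
Proof.
intros Hh Hk Heven.
set (H := fun y => h y * kap (y - x)).
assert (CH : forall y, continuous H y).
{ intros y. apply cont_mult; [apply Hh|].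
  apply (cont_comp kap (fun y => y - x)); [|apply Hk].
  apply cont_minus; [apply continuous_id|apply continuous_const]. }
assert (Cp : forall r, continuous (fun r => h (x + r) * kap r) r).
{ intros r. apply cont_mult; [|apply Hk].
  apply (cont_comp h (fun r => x + r)); [|apply Hh].
  apply cont_plus; [apply continuous_const|apply continuous_id]. }
assert (Cm : forall r, continuous (fun r => h (x - r) * kap r) r).
{ intros r. apply cont_mult; [|apply Hk].
  apply (cont_comp h (fun r => x - r)); [|apply Hh].
  apply cont_minus; [apply continuous_const|apply continuous_id]. }
assert (Hp : RInt (fun r => h (x + r) * kap r) 0 d = RInt H x (x + d)).
{ assert (Hl := RInt_comp_lin (V := R_CompleteNormedModule) H 1 x 0 d
    (ex_RInt_R H _ _ CH)).
  change (RInt (fun r => 1 * H (1 * r + x)) 0 d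
    = RInt H (1 * 0 + x) (1 * d + x)) in Hl.
  replace (1 * 0 + x) with x in Hl by ring.
  replace (1 * d + x) with (x + d) in Hl by ring.
  rewrite <- Hl. apply RInt_R_ext. intros r _. unfold H.
  replace (1 * r + x - x) with r by ring. replace (1 * r + x) with (x + r) by ring.
  ring. }
assert (Hm : RInt (fun r => h (x - r) * kap r) 0 d = - RInt H x (x - d)).
{ assert (Hl := RInt_comp_lin (V := R_CompleteNormedModule) H (-1) x 0 d
    (ex_RInt_R H _ _ CH)).
  change (RInt (fun r => -1 * H (-1 * r + x)) 0 d
    = RInt H (-1 * 0 + x) (-1 * d + x)) in Hl.
  replace (-1 * 0 + x) with x in Hl by ring.
  replace (-1 * d + x) with (x - d) in Hl by ring.
  rewrite <- Hl.
  rewrite <- (Ropp_involutive (RInt (fun r => h (x - r) * kap r) 0 d)). f_equal.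
  rewrite <- (Rmult_1_l (RInt (fun r => h (x - r) * kap r) 0 d)), Ropp_mult_distr_l.
  rewrite <- RInt_R_scal by now apply ex_RInt_R.
  apply RInt_R_ext. intros r _. unfold H.
  replace (-1 * r + x - x) with (- r) by ring.
  replace (-1 * r + x) with (x - r) by ring. rewrite Heven. ring. }
transitivity (RInt (fun r => h (x + r) * kap r) 0 d
  + RInt (fun r => h (x - r) * kap r) 0 d).
- rewrite Hp, Hm.
  assert (Hc := RInt_Chasles (V := R_CompleteNormedModule) H (x - d) x (x + d)
    (ex_RInt_R _ _ _ CH) (ex_RInt_R _ _ _ CH)).
  assert (Hs := opp_RInt_swap (V := R_CompleteNormedModule) H x (x - d)
    (ex_RInt_R _ _ _ CH)).
  unfold plus in Hc; simpl in Hc. unfold opp in Hs; simpl in Hs. lra.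
- rewrite <- RInt_R_plus by now apply ex_RInt_R.
  apply RInt_R_ext. intros r _. unfold refl_sum. ring.
Qed.

(** The functional of Riemann's method is differentiable after the initial time
    and continuous at it; the mean value theorem covers the end point. *)
Lemma ftc_interior (J S : R -> R) (a b : R) :
  a <= b ->
  (forall s, a < s < b -> is_derive J s (S s)) ->
  (forall s, a <= s <= b -> continuous J s) ->
  (forall s, continuous S s) ->
  J b - J a = RInt S a b.
Proof.
intros hab HD HJ HS.
assert (DS : forall s, is_derive (fun s => RInt S a s) s (S s)).
{ intros s. apply (is_derive_RInt S _ a); [|apply HS].
  apply filter_forall. intros z.
  now apply (RInt_correct (V := R_CompleteNormedModule)), ex_RInt_R. }
destruct (MVT_gen (fun s => J s - RInt S a s) a b (fun _ => 0)) as (s & _ & Hs).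
- rewrite Rmin_left, Rmax_right by lra. intros s hs.
  apply (is_derive_R_eq _ _ (S s - S s)); [|ring].
  exact (is_derive_minus _ _ _ _ _ (HD s hs) (DS s)).
- rewrite Rmin_left, Rmax_right by lra. intros s hs.
  apply continuity_pt_filterlim. apply (cont_minus J); [now apply HJ|].
  apply is_derive_R_continuous with (S s). apply DS.
- assert (H0 := RInt_point (V := R_CompleteNormedModule) a S).
  unfold zero in H0; simpl in H0. lra.
Qed.

Lemma kern_even (P : R -> R) (T B r : R) : kern P T B (- r) = kern P T B r.
Proof. unfold kern, zeta. do 3 f_equal. ring. Qed.

Lemma kern_T_even (P1 : R -> R) (T B r : R) :
  kern_T P1 T B (- r) = kern_T P1 T B r.
Proof.
unfold kern_T, zeta, zeta_T. replace ((- r) ^ 2) with (r ^ 2) by ring. reflexivity.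
Qed.

Section Representation.

Variables (k : R) (P P1 P2 : R -> R).
Hypothesis hk : 0 < k < 1.
Hypothesis HP : legendre_profile (wave_mu k) P P1 P2.
Hypothesis HPz : forall z, 0 <= z -> P z = pfaff (gamma k) z.

Lemma K1_eq_kern (t x y : R) :
  1 <= t -> (y - x) ^ 2 <= (phi k t - phi k 1) ^ 2 ->
  K1 k t x y = Rpower t (k / 2 - 1) * kern P (phi k t) (phi k 1) (y - x).
Proof.
intros ht hy. unfold K1. rewrite (E_eq_kern k hk P) by (auto; lra).
rewrite Rpower_1_l. ring.
Qed.

(** Strictly inside the cone the identity between [E] and the kernel holds
    for [b] near 1, so it may be differentiated there. *)
Lemma K0_eq_kern (t x y : R) :
  1 <= t -> Rabs (y - x) < phi k t - phi k 1 ->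
  K0 k t x y = Rpower t (k / 2 - 1)
    * ((1 - k / 2) * kern P (phi k t) (phi k 1) (y - x)
       - kern_T P1 (phi k 1) (phi k t) (y - x)).
Proof.
intros ht hy.
assert (hT := phi_pos k hk t). assert (hB := phi_pos k hk 1).
unfold K0.
assert (hsq : forall s, Rabs (y - x) < phi k t - phi k s ->
  (y - x) ^ 2 <= (phi k t - phi k s) ^ 2).
{ intros s hs. assert (H0 := Rabs_pos (y - x)). rewrite <- (pow2_abs (y - x)). nra. }
rewrite (E_eq_kern k hk P t x 1 y) by (try apply hsq; auto; lra).
rewrite (is_derive_unique _ 1 (Rpower t (k / 2 - 1)
  * ((1 + k / 2) * kern P (phi k t) (phi k 1) (y - x)
     + kern_T P1 (phi k 1) (phi k t) (y - x)))).
{ rewrite Rpower_1_l. field. }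
apply is_derive_R_ext_loc with (fun b => Rpower t (k / 2 - 1)
  * (Rpower b (1 + k / 2) * kern P (phi k t) (phi k b) (y - x))).
- assert (L1 : locally 1 (fun b => 0 < b)).
  { apply (locally_open (fun b => 0 < b)); auto; [apply open_gt|lra]. }
  assert (L2 : locally 1 (fun b => phi k b < phi k t - Rabs (y - x))).
  { assert (C : continuous (phi k) 1).
    { eapply is_derive_R_continuous. apply is_derive_phi; lra. }
    apply (C (fun s => s < phi k t - Rabs (y - x))).
    apply (locally_open (fun s => s < phi k t - Rabs (y - x))); auto.
    - apply open_lt.
    - lra. }
  generalize (filter_and _ _ L1 L2). apply filter_imp. intros b [h1 h2].
  rewrite (E_eq_kern k hk P t x b y) by (try apply hsq; auto; lra). ring.
- apply is_derive_R_scal.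
  assert (H1 := is_derive_Rpower 1 (1 + k / 2) Rlt_0_1).
  assert (H2 := is_derive_R_comp (fun B => kern P (phi k t) B (y - x)) (phi k) 1 _ _
    (is_derive_kern_B (wave_mu k) P P1 P2 HP _ _ (y - x) hT hB)
    (is_derive_phi k hk 1 Rlt_0_1)).
  apply (is_derive_R_eq _ _ _ _ (is_derive_R_mult _ _ _ _ _ H1 H2)).
  rewrite !Rpower_1_l. field.
Qed.

Section Flatten.

Variables (g u ut ux utt uxx : R -> R -> R).
Hypotheses (Cu : continuous_half u) (Cut : continuous_half ut)
  (Cutt : continuous_half utt) (Cuxx : continuous_half uxx)
  (Cg : continuous_half g).
Hypothesis Dt : forall t x, 1 < t -> is_derive (fun s => u s x) t (ut t x).
Hypothesis Dtt : forall t x, 1 < t -> is_derive (fun s => ut s x) t (utt t x).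
Hypothesis Dx : forall t x, 1 < t -> is_derive (u t) x (ux t x).
Hypothesis Dxx : forall t x, 1 < t -> is_derive (ux t) x (uxx t x).
Hypothesis Heq : forall t x, 1 < t ->
  utt t x - Rpower t (- (2 * k)) * uxx t x + 2 * / t * ut t x = g t x.

Let e := 1 - k / 2.

Definition at_clock (v : R -> R -> R) (T x : R) : R := v (clock k T) x.
Definition weighted (a : R) (v : R -> R -> R) (t x : R) : R := Rpower t a * v t x.

(** The derivative of the original time in [T] is its [k]-th power, which is why
    each derivative in [B] adds [k] to the exponents. *)
Definition flat_w : R -> R -> R := at_clock (weighted e u).
Definition flat_wB : R -> R -> R :=
  at_clock (fun t x => e * weighted (e - 1 + k) u t x + weighted (e + k) ut t x).
Definition flat_wBB : R -> R -> R :=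
  at_clock (fun t x => e * ((e - 1 + k) * weighted (e - 1 + k - 1 + k) u t x
                      + weighted (e - 1 + k + k) ut t x)
     + ((e + k) * weighted (e + k - 1 + k) ut t x + weighted (e + k + k) utt t x)).

Lemma cont_weighted (a : R) (v : R -> R -> R) (T x : R) :
  continuous_half v -> cont2 (at_clock (weighted a v)) T x.
Proof.
intros Hv. unfold at_clock, weighted. apply cont_mult; [now apply cont_clock_power|].
apply (cont2_half_comp v (clock k) Hv (clock_ge_1 k hk) (cont_clock k hk)).
Qed.

Lemma is_derive_weighted (a : R) (v vt : R -> R -> R) (B y : R) :
  (forall t, 1 < t -> is_derive (fun s => v s y) t (vt t y)) ->
  phi k 1 < B ->
  is_derive (fun B => at_clock (weighted a v) B y) B
    (at_clock (fun t x => a * weighted (a - 1 + k) v t x + weighted (a + k) vt t x) B y).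
Proof.
intros Hv hB.
assert (hB0 : 0 < B) by (assert (H := phi_pos k hk 1); lra).
assert (h1 := psi_gt_1 k hk B hB).
apply is_derive_R_ext_loc with (fun B => weighted a v (psi k B) y).
- assert (L : locally B (fun B => phi k 1 < B)).
  { apply (locally_open (fun B => phi k 1 < B)); auto. apply open_gt. }
  revert L. apply filter_imp. intros B' hB'. unfold at_clock.
  now rewrite clock_eq by lra.
- unfold at_clock. rewrite clock_eq by lra.
  assert (H := is_derive_R_comp (fun t => weighted a v t y) (psi k) B _ _
    (is_derive_R_mult _ _ _ _ _ (is_derive_Rpower (psi k B) a ltac:(lra)) (Hv _ h1))
    (is_derive_psi k hk B hB0)).
  apply (is_derive_R_eq _ _ _ _ H). unfold weighted. rewrite !Rpower_plus.
  rewrite Rpower_minus1 by lra. field. lra.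
Qed.

Lemma flat_equation (B y : R) :
  phi k 1 < B ->
  flat_wBB B y - at_clock (weighted e uxx) B y
  = wave_mu k / B ^ 2 * flat_w B y + flat_source k g B y.
Proof.
intros hB.
assert (hB0 : 0 < B) by (assert (H := phi_pos k hk 1); lra).
assert (h1 := psi_gt_1 k hk B hB).
unfold flat_wBB, flat_w, flat_source, at_clock. rewrite clock_eq by lra.
set (t := psi k B) in *.
assert (ht : 0 < t) by lra.
rewrite <- (phi_psi k hk B hB0). fold t. rewrite (phi_eq k t ht).
rewrite <- (Heq t y h1).
unfold weighted. rewrite !Rpower_plus, !Rpower_minus1, !Rpower_plus, !Rpower_minus1 by exact ht.
set (a := Rpower t e). set (Q := Rpower t k).
assert (hQ : 0 < Q) by apply Rpower_pos.
assert (ha : 0 < a) by apply Rpower_pos.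
replace (Rpower t (- k)) with (/ Q) by (unfold Q; now rewrite Rpower_Ropp).
replace (Rpower t (- (2 * k))) with (/ (Q * Q)).
2: { unfold Q. rewrite <- Rpower_plus, <- Rpower_Ropp. f_equal. ring. }
rewrite (Rpower_1 t ht).
replace (t * Rpower t (3 * k / 2)) with (a * Q * Q).
2: { unfold a, Q. rewrite <- (Rpower_1 t ht) at 4. rewrite <- !Rpower_plus.
     f_equal. unfold e. field. }
unfold wave_mu, gamma, e. field. repeat split; lra.
Qed.

Lemma flat_representation (T x : R) :
  phi k 1 <= T ->
  let T0 := phi k 1 in
  (forall B, 0 < B -> continuous (riemann_functional P P1 flat_w flat_wB T x) B) /\
  (forall B, T0 < B -> B <= T ->
     is_derive (riemann_functional P P1 flat_w flat_wB T x) B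
       (RInt (fun r => refl_sum 1 (flat_source k g B) x r * kern P T B r) 0 (T - B))).
Proof.
intros hT T0. assert (hT0 := phi_pos k hk 1).
assert (Cw : forall B y, cont2 flat_w B y).
{ intros B y. now apply cont_weighted. }
assert (CwB : forall B y, cont2 flat_wB B y).
{ intros B y. apply cont_plus; [apply cont_mult; [apply continuous_const|]|];
    now apply cont_weighted. }
split.
- intros B hB. apply (cont_riemann_functional (wave_mu k) P P1 P2 HP); auto. lra.
- intros B hB hBT.
  apply (is_derive_riemann_functional (wave_mu k) P P1 P2 HP T0 (flat_source k g)
    flat_w flat_wB flat_wBB (at_clock (weighted e ux)) (at_clock (weighted e uxx))); auto.
  + intros B' y. now apply cont_flat_source.
  + intros B' y _.
    apply cont_plus; [apply cont_mult; [apply continuous_const|]|];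
      (apply cont_plus; [apply cont_mult; [apply continuous_const|]|]);
      now apply cont_weighted.
  + intros B' y _. now apply cont_weighted.
  + intros B' y hB'. apply is_derive_weighted; auto.
  + intros B' y hB'. apply is_derive_R_plus; [apply is_derive_R_scal|].
    * apply (is_derive_weighted _ u ut); auto.
    * apply (is_derive_weighted _ ut utt); auto.
  + intros B' y hB'. apply is_derive_R_scal, Dx. rewrite clock_eq by (unfold T0 in *; lra).
    now apply psi_gt_1.
  + intros B' y hB'. apply is_derive_R_scal, Dxx. rewrite clock_eq by (unfold T0 in *; lra).
    now apply psi_gt_1.
  + intros B' y hB'. now apply flat_equation.
Qed.

End Flatten.
End Representation.

Lemma representation (k : R) (u0 u1 : R -> R) (g u : R -> R -> R) (t x : R) :
  0 < k < 1 -> (forall y, continuous u0 y) -> (forall y, continuous u1 y) ->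
  continuous_half g -> is_solution k u0 u1 g u -> 1 <= t ->
  u t x =
    1 / 2 * Rpower t (k / 2 - 1) * (u0 (x + A k t) + u0 (x - A k t))
    + RInt (fun y => u0 y * K0 k t x y) (x - A k t) (x + A k t)
    + RInt (fun y => u1 y * K1 k t x y) (x - A k t) (x + A k t)
    + RInt (fun b =>
        RInt (fun y => g b y * E k t x b y)
          (x - phi k t + phi k b) (x + phi k t - phi k b)) 1 t.
Proof.
intros hk C0 C1 Cg (HC2 & Heq & Hu0 & Hu1) ht.
destruct HC2 as (Cu & ut & ux & Dtx & Ct & Cx).
destruct Ct as (Cut & utt & utx & Dttx & [Cutt _] & _).
destruct Cx as (_ & uxt & uxx & Dxtx & _ & [Cuxx _]).
assert (Dt : forall t x, 1 < t -> is_derive (fun s => u s x) t (ut t x)).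
{ intros s y hs. apply is_derive_of_half; [exact hs|]. apply Dtx. lra. }
assert (Dtt : forall t x, 1 < t -> is_derive (fun s => ut s x) t (utt t x)).
{ intros s y hs. apply is_derive_of_half; [exact hs|]. apply Dttx. lra. }
assert (Dx : forall t x, 1 < t -> is_derive (u t) x (ux t x)).
{ intros s y hs. apply Dtx. lra. }
assert (Dxx : forall t x, 1 < t -> is_derive (ux t) x (uxx t x)).
{ intros s y hs. apply Dxtx. lra. }
assert (Heq' : forall t x, 1 < t ->
  utt t x - Rpower t (- (2 * k)) * uxx t x + 2 * / t * ut t x = g t x).
{ intros s y hs. rewrite <- (Heq s y hs).
  rewrite (Derive_n_2 (fun s => u s y) (fun s => ut s y) s (utt s y)).
  2: { apply (locally_open (fun s => 1 < s)); auto. apply open_gt. }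
  2: now apply Dtt.
  rewrite (Derive_n_2 (fun y => u s y) (ux s) y (uxx s y)).
  2: { apply filter_forall. intros z. now apply Dx. }
  2: now apply Dxx.
  replace (Derive (fun s => u s y) s) with (ut s y); [reflexivity|].
  symmetry. now apply is_derive_unique, Dt. }
assert (Hut : forall y, ut 1 y = u1 y).
{ intros y. apply (is_derive_half_unique (fun s => u s y) 1); [lra| |apply Hu1].
  apply Dtx. lra. }
destruct (legendre_profile_exists (gamma k) (gamma_le_1 k hk))
  as (P & P1 & P2 & HP & HPz).
fold (wave_mu k) in HP.
set (T := phi k t). set (T0 := phi k 1).
assert (hT : 0 < T) by now apply phi_pos.
assert (hT0 : 0 < T0) by now apply phi_pos.
assert (hT0T : T0 <= T) by (apply phi_le; lra).
set (a := Rpower t (k / 2 - 1)).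
destruct (flat_representation k P P1 P2 hk HP g u ut ux utt uxx
  Cu Cut Cutt Cuxx Cg Dt Dtt Dx Dxx Heq' T x hT0T) as [CI DI].
set (w := flat_w k u) in *. set (wB := flat_wB k u ut) in *.
set (I := riemann_functional P P1 w wB T x) in *.
assert (HwT : u t x = a * I T).
{ unfold I. rewrite riemann_functional_apex. unfold w, flat_w, at_clock, weighted, T, a.
  rewrite clock_phi by assumption. rewrite <- Rmult_assoc, <- Rpower_plus.
  replace (k / 2 - 1 + (1 - k / 2)) with 0 by field. rewrite Rpower_O by lra. ring. }
assert (Hw0 : forall y, w T0 y = u0 y).
{ intros y. unfold w, flat_w, at_clock, weighted, T0. rewrite clock_phi, Rpower_1_l by (auto; lra).
  rewrite Hu0. ring. }
assert (HwB0 : forall y, wB T0 y = (1 - k / 2) * u0 y + u1 y).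
{ intros y. unfold wB, flat_wB, at_clock, weighted, T0.
  rewrite clock_phi, !Rpower_1_l by (auto; lra). rewrite Hu0, Hut. ring. }
(* the clamp at 1 makes the integrand continuous on the whole line *)
set (S := fun b => Rpower (Rmax b 1) (- k)
  * layer 1 (flat_source k g) (kern P) T x (phi k (Rmax b 1))).
assert (Hmax : forall b, 0 < Rmax b 1).
{ intros b. assert (H := Rmax_r b 1). lra. }
assert (CS : forall b, continuous S b).
{ intros b.
  assert (Cm : continuous (fun b => Rmax b 1) b) by apply cont_Rmax, continuous_id.
  apply cont_mult.
  - apply (cont_comp (fun t => Rpower t (- k))); [exact Cm|]. now apply cont_Rpower.
  - apply (cont_layer 1 (flat_source k g) (kern P)) with (T := fun _ : R => T)
      (x := fun _ : R => x) (B := fun b => phi k (Rmax b 1)).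
    + intros s y. now apply cont_flat_source.
    + exact (cont_kern (wave_mu k) P P1 P2 HP).
    + apply continuous_const.
    + apply continuous_const.
    + apply (cont_comp (phi k)); [exact Cm|].
      eapply is_derive_R_continuous. now apply is_derive_phi.
    + split; [exact hT|now apply phi_pos]. }
assert (HI : I T - I T0 = RInt S 1 t).
{ apply (ftc_interior (fun b => I (phi k b)) S 1 t ht).
  - intros b hb.
    assert (Hb : phi k b <= T) by (apply phi_le; lra).
    assert (Hb0 : T0 < phi k b) by (apply phi_lt; lra).
    apply (is_derive_R_eq _ _ _ _ (is_derive_R_comp I (phi k) b _ _
      (DI (phi k b) Hb0 Hb) (is_derive_phi k hk b ltac:(lra)))).
    unfold S. rewrite Rmax_left by lra. apply Rmult_comm.
  - intros b hb. apply (cont_comp I (phi k)); [|apply CI, phi_pos, hk].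
    eapply is_derive_R_continuous. apply is_derive_phi; [exact hk|lra].
  - exact CS. }
assert (Ck : forall B r, 0 < B -> continuous (fun r => kern P T B r) r).
{ intros B r hB. eapply is_derive_R_continuous.
  now apply (is_derive_kern_r (wave_mu k) P P1 P2 HP). }
assert (CkT : forall r, continuous (fun r => kern_T P1 T0 T r) r).
{ intros r. apply (cont_kern_T (wave_mu k) P P1 P2 HP _ (fun _ => T0) (fun _ => T)
    (fun r => r)); auto; try apply continuous_const; apply continuous_id. }
set (kap := fun r => (1 - k / 2) * kern P T T0 r - kern_T P1 T0 T r).
assert (Ckap : forall r, continuous kap r).
{ intros r. apply cont_minus; [apply cont_mult; [apply continuous_const|]|]; auto. }
assert (HA : A k t = T - T0) by reflexivity.
assert (Hin : forall y, x - A k t < y < x + A k t -> Rabs (y - x) < T - T0).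
{ intros y. rewrite HA. intros hy. unfold Rabs. destruct Rcase_abs; lra. }
assert (HK0 : RInt (fun y => u0 y * K0 k t x y) (x - A k t) (x + A k t)
  = a * RInt (fun r => refl_sum 1 u0 x r * kap r) 0 (T - T0)).
{ rewrite <- HA, <- (RInt_refl_sum u0 kap x (A k t)); auto.
  2: { intros r. unfold kap. now rewrite kern_even, kern_T_even. }
  rewrite <- RInt_R_scal.
  - apply RInt_R_ext. intros y. rewrite Rmin_left, Rmax_right by (rewrite HA; lra).
    intros hy. apply Hin in hy.
    rewrite (K0_eq_kern k P P1 P2 hk HP HPz t x y ht hy).
    fold T T0 a. unfold kap. ring.
  - apply ex_RInt_R. intros y. apply cont_mult; [apply C0|].
    apply (cont_comp kap (fun y => y - x)); [|apply Ckap].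
    apply cont_minus; [apply continuous_id|apply continuous_const]. }
assert (HK1 : RInt (fun y => u1 y * K1 k t x y) (x - A k t) (x + A k t)
  = a * RInt (fun r => refl_sum 1 u1 x r * kern P T T0 r) 0 (T - T0)).
{ rewrite <- HA, <- (RInt_refl_sum u1 (fun r => kern P T T0 r) x (A k t)); auto.
  2: { intros r. apply kern_even. }
  rewrite <- RInt_R_scal.
  - apply RInt_R_ext. intros y. rewrite Rmin_left, Rmax_right by (rewrite HA; lra).
    intros hy. apply Hin in hy.
    rewrite (K1_eq_kern k P hk HPz t x y ht).
    + fold T T0 a. ring.
    + fold T T0. assert (H0 := Rabs_pos (y - x)). rewrite <- (pow2_abs (y - x)). nra.
  - apply ex_RInt_R. intros y. apply cont_mult; [apply C1|].
    apply (cont_comp (fun r => kern P T T0 r) (fun y => y - x)); [|auto].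
    apply cont_minus; [apply continuous_id|apply continuous_const]. }
assert (HE : RInt (fun b => RInt (fun y => g b y * E k t x b y)
    (x - T + phi k b) (x + T - phi k b)) 1 t = a * RInt S 1 t).
{ rewrite <- RInt_R_scal by now apply ex_RInt_R.
  apply RInt_R_ext. intros b. rewrite Rmin_left, Rmax_right by lra. intros hb.
  unfold S. rewrite Rmax_left by lra. unfold layer.
  set (B := phi k b).
  assert (hB : 0 < B) by now apply phi_pos.
  assert (hBT : B <= T) by (apply phi_le; lra).
  assert (Cs : forall y, continuous (flat_source k g B) y).
  { intros y. apply (cont_comp_2 (flat_source k g) (fun _ => B) (fun y => y)).
    - apply continuous_const.
    - apply continuous_id.
    - now apply cont_flat_source. }
  rewrite <- (RInt_refl_sum (flat_source k g B) (fun r => kern P T B r) x (T - B)); auto.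
  2: { intros r. apply kern_even. }
  assert (CF : forall y, continuous
    (fun y => flat_source k g B y * kern P T B (y - x)) y).
  { intros y. apply cont_mult; [apply Cs|].
    apply (cont_comp (fun r => kern P T B r) (fun y => y - x)); [|auto].
    apply cont_minus; [apply continuous_id|apply continuous_const]. }
  rewrite <- !RInt_R_scal by (apply ex_RInt_R; intros y;
    repeat first [apply CF | apply cont_mult; [apply continuous_const|]]).
  replace (x - T + B) with (x - (T - B)) by ring.
  replace (x + T - B) with (x + (T - B)) by ring.
  apply RInt_R_ext. intros y. rewrite Rmin_left, Rmax_right by lra. intros hy.
  rewrite (E_eq_kern k hk P t x b y HPz) by (fold T B; lra || nra).
  fold T B a. unfold flat_source, B. rewrite (clock_phi k hk b) by lra.
  replace (Rpower b (1 + k / 2)) with (Rpower b (- k) * Rpower b (1 + 3 * k / 2)).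
  - ring.
  - rewrite <- Rpower_plus. f_equal. field. }
assert (HI0 : I T0 = RInt (fun r => refl_sum 1 u0 x r * kap r) 0 (T - T0)
  + RInt (fun r => refl_sum 1 u1 x r * kern P T T0 r) 0 (T - T0)
  + / 2 * (u0 (x + A k t) + u0 (x - A k t))).
{ assert (Cf : forall v : R -> R, (forall y, continuous v y) ->
    forall r, continuous (fun r => refl_sum 1 v x r) r).
  { intros v Hv r.
    assert (C2 : forall y, cont2 (fun _ : R => v) 0 y).
    { intros y. apply (cont_comp v snd); [apply continuous_snd|apply Hv]. }
    apply (cont_refl_sum 1 (fun _ : R => v) (fun _ => 0) (fun _ => x) (fun r => r)); auto;
      try apply continuous_const; apply continuous_id. }
  unfold I, riemann_functional.
  rewrite <- RInt_R_plus by (apply ex_RInt_R; intros r; apply cont_mult; auto).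
  f_equal.
  - apply RInt_R_ext. intros r _. unfold riemann_flux, refl_sum, kap.
    rewrite !Hw0, !HwB0. ring.
  - unfold refl_sum. rewrite !Hw0, <- HA. ring. }
rewrite HwT, HK0, HK1, HE, <- HI, HI0. field.
Qed.

Theorem corollary2p2 (k : R) (u0 u1 : R -> R) (g : R -> R -> R)
  (hk : 0 < k < 1)
  (hu0 : class_C 2 u0) (hu1 : class_C 1 u1) (hg : class_C01 g) :
  (exists u : R -> R -> R, is_solution k u0 u1 g u) /\
  (forall u : R -> R -> R, is_solution k u0 u1 g u ->
   forall t x : R, 1 <= t ->
   u t x =
     1 / 2 * Rpower t (k / 2 - 1) * (u0 (x + A k t) + u0 (x - A k t))
     + RInt (fun y => u0 y * K0 k t x y) (x - A k t) (x + A k t)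
     + RInt (fun y => u1 y * K1 k t x y) (x - A k t) (x + A k t)
     + RInt (fun b =>
         RInt (fun y => g b y * E k t x b y)
           (x - phi k t + phi k b) (x + phi k t - phi k b)) 1 t).
Proof.
split.
- now apply solution_exists.
- intros u Hu t x ht. apply representation; auto.
  + intros y. exact (is_derive_R_continuous _ _ _ (proj1 (class_C_2 u0 hu0) y)).
  + intros y. exact (is_derive_R_continuous _ _ _ (proj1 (class_C_1 u1 hu1) y)).
  + apply hg.
Qed.
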